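(* Let $G$ be a finite abelian group of rank $r$. Then for every subset $A\subseteq G$ the following assertions are equivalent: (i) $\operatorname{diam}_A(G)=\operatorname{diam}(G)$; (ii) there exists a standard generating set $B=\{b_1,\ldots,b_r\}$ for $G$ such that $$B^\pm\subseteq A^\pm\subseteq\big(B\cup\{b_{2i-1}+b_{2i}: i\in\mathbb{Z},\ 1\le i\le \nu_3(G)/2\}\big)^\pm.$$
   Context: For a subset $A$ of a finite abelian group $G$ (written additively) put $A^\pm:=(-A)\cup\{0\}\cup A$, and for an integer $\rho\ge 0$ let $\langle A\rangle_\rho:=\{a_1+\dotsb+a_\rho: a_i\in A^\pm\}$ (with $\langle A\rangle_0=\{0\}$). The diameter of $G$ with respect to $A$ is $\operatorname{diam}_A(G):=\min\{\rho\ge 0:\langle A\rangle_\rho=G\}$, with $\min\varnothing=\infty$. The absolute diameter is $\operatorname{diam}(G):=\max\{\operatorname{diam}_A(G): A\subseteq G,\ \langle A\rangle=G\}$. The group $G$ has type $(m_1,\ldots,m_r)$ if $G\cong\mathbb{Z}_{m_1}\oplus\dotsb\oplus\mathbb{Z}_{m_r}$ with $1\neq m_1\mid\dotsb\mid m_r$; then $r$ is the rank of $G$ (the trivial group has type $()$ and rank $0$). A standard generating set for $G$ is a subset $\{b_1,\ldots,b_r\}\subseteq G$ such that $G=\langle b_1\rangle\oplus\dotsb\oplus\langle b_r\rangle$ and $\operatorname{ord}(b_i)=m_i$ for all $1\le i\le r$ (the trivial group has the unique standard generating set $\varnothing$). For a positive integer $m$, $\nu_m(G):=\#\{i\in\{1,\ldots,r\}: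 m_i=m\}$. (If $\nu_3(G)\neq 0$, then $m_i=3$ for exactly the indices $1\le i\le\nu_3(G)$.) *)

(* Defs.v *)
From mathcomp Require Import all_boot all_fingroup all_solvable.

Set Implicit Arguments.
Unset Strict Implicit.
Unset Printing Implicit Defensive.

Local Open Scope group_scope.

(* Abelian groups are written multiplicatively. The operations on {set gT} are
   pointwise: A^-1 is the set of inverses of elements of A, and A ^+ n is the
   set of all products of n elements of A (so A ^+ 0 is [set 1]). *)

Definition sym (gT : finGroupType) (A : {set gT}) : {set gT} :=
  A^-1 :|: [set 1] :|: A.

Definition ball (gT : finGroupType) (A : {set gT}) (rho : nat) : {set gT} :=
  sym A ^+ rho.

Lemma ball_decidable (gT : finGroupType) (G : {group gT}) (A : {set gT}) :
  decidable (exists rho, ball A rho == G).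
Proof.
have sA : A \subset sym A by rewrite subsetUr.
have sym1 : 1 |: sym A = sym A.
  by apply/setUidPr; rewrite sub1set /sym !inE eqxx orbT.
have sym_gen : sym A \subset <<A>>.
  by rewrite /sym !subUset sub1G subset_gen -invSg invgK invGid subset_gen.
have ball_gen rho : ball A rho \subset <<A>>.
  by elim: rho => [|n IH]; rewrite /ball ?expg0 ?sub1G // expgS mul_subG.
apply: (@decP _ ((<<A>> == G) || (G :==: 1))).
apply: (iffP orP) => [[/eqP AG|/eqP G1]|[rho]].
- have [n An] := gen_expgs (sym A); exists n.
  rewrite /ball -sym1 -An -AG eqEsubset !gen_subG sym_gen /=.
  exact: subset_trans sA (subset_gen _).
- by exists 0; rewrite /ball expg0 G1.
case: rho => [/eqP <-|rho /eqP ballG]; first by right; rewrite /ball expg0.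
left; rewrite eqEsubset -{2}ballG ball_gen andbT gen_subG -ballG /ball expgS.
have : 1 \in sym A ^+ rho.
  elim: rho {ballG} => [|n IH]; first by rewrite expg0 set11.
  by rewrite expgS -[1]mulg1 mem_mulg // -sym1 setU11.
move=> s1; apply: subset_trans sA _; apply/subsetP=> x sx.
by rewrite -[x]mulg1 mem_mulg.
Qed.

(* Elements of option nat stand for nat extended with infinity := None. *)

Definition diam_wrt (gT : finGroupType) (A : {set gT}) (G : {group gT}) :
    option nat :=
  if ball_decidable G A is left ex_rho then Some (ex_minn ex_rho) else None.

Definition max_ext (x y : option nat) : option nat :=
  if (x, y) is (Some m, Some n) then Some (maxn m n) else None.

Definition diam (gT : finGroupType) (G : {group gT}) : option nat :=
  \big[max_ext/Some 0]_(A : {set gT} | (A \subset G) && (<<A>> == G))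
    diam_wrt A G.

(* abelian_type lists the invariant factors in decreasing order. *)
Definition ab_type (gT : finGroupType) (G : {group gT}) : seq nat :=
  rev (abelian_type G).

(* <[x]> is cyclic of order #[x], so this characterizes the sequences m with
   1 != m_1 %| ... %| m_r and G isomorphic to Z_(m_1) (+) ... (+) Z_(m_r). *)
Lemma ab_typeP (gT : finGroupType) (G : {group gT}) (m : seq nat) :
    abelian G ->
  ab_type G = m <->
    [/\ all (ltn 1%N) m, sorted dvdn m &
        exists2 b : seq gT, \big[dprod/1]_(x <- b) <[x]> = G
                          & [seq #[x] | x <- b] = m].
Proof.
have revD (s : seq gT) : \big[dprod/1]_(x <- rev s) <[x]>
    = \big[dprod/1]_(x <- s) <[x]> by apply: perm_big; rewrite perm_rev.
have uniq_type (s t : seq nat) :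
    sorted [rel m n | n %| m] s -> sorted [rel m n | n %| m] t ->
    all (ltn 1%N) s -> all (ltn 1%N) t ->
    (forall p n, count [pred x | logn p x > n] s
               = count [pred x | logn p x > n] t) -> s = t.
  have dvdT : transitive [rel m n | n %| m].
    by move=> y x z /= xy yz; apply: dvdn_trans yz xy.
  have pos x (u : seq nat) : all (ltn 1%N) (x :: u) ->
      count [pred y | logn (pdiv x) y > 0] (x :: u) != 0.
    case/andP=> x1 _; rewrite -lt0n -has_count /= logn_gt0.
    apply/orP; left.
    by rewrite mem_primes pdiv_prime ?pdiv_dvd ?(ltnW x1).
  have cnt p n x (u : seq nat) : sorted [rel m n | n %| m] (x :: u) ->
      all (ltn 1%N) (x :: u) ->
      (0 < count [pred y | logn p y > n] (x :: u)) = (n < logn p x).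
    rewrite /= path_sortedE // => /andP[/allP xu _] /andP[x1 _].
    apply/idP/idP; last by move=> ->.
    rewrite -/(count _ (x :: u)) -has_count => /hasP[y]; rewrite inE.
    case/predU1P=> [-> //|/xu /= yx] /= ny.
    by apply: leq_trans ny (dvdn_leq_log _ _ yx); apply: ltnW.
  elim: s t => [|x s IH] [|y t] // sx sy ax ay eqc.
  - by have := pos _ _ ay; rewrite -eqc.
  - by have := pos _ _ ax; rewrite eqc.
  have xy : x = y.
    have [/andP[/ltnW x0 _] /andP[/ltnW y0 _]] := (ax, ay).
    apply: eqn_from_log => // p.
    have E n : (n < logn p x) = (n < logn p y).
      by rewrite -(cnt p n x s) // -(cnt p n y t) // eqc.
    by apply/eqP; rewrite eqn_leq leqNgt E ltnn leqNgt -E ltnn.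
  congr (_ :: _) => //; apply: IH.
  - exact: path_sorted sx.
  - exact: path_sorted sy.
  - by case/andP: ax.
  - by case/andP: ay.
  by move=> p n; have := eqc p n; rewrite /= xy => /addnI.
move=> cGG; have [c defG defT] := abelian_structure cGG.
split=> [<-|[m1 sm [b bG bm]]].
  split; rewrite ?all_rev ?abelian_type_gt1 ?rev_sorted //.
    exact: abelian_type_dvdn_sorted.
  by exists (rev c); rewrite ?revD ?map_rev ?defT.
apply: (canLR revK); apply: uniq_type; rewrite ?all_rev ?abelian_type_gt1 //.
- exact: abelian_type_dvdn_sorted.
- by rewrite rev_sorted.
move=> p n; rewrite count_rev -defT -bm !count_map.
rewrite [LHS](@count_logn_dprod_cycle _ p n _ _ defG).
by rewrite [RHS](@count_logn_dprod_cycle _ p n _ _ bG).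
Qed.

Definition nu (gT : finGroupType) (m : nat) (G : {group gT}) : nat :=
  count_mem m (ab_type G).

Definition standard_generating_seq (gT : finGroupType) (G : {group gT})
    (b : seq gT) : Prop :=
  \big[dprod/1]_(x <- b) <[x]> = G /\ [seq #[x] | x <- b] = ab_type G.

(* The products b_(2i-1) * b_(2i) with 1 <= i <= k / 2, where b_j is the entry
   of index j - 1 of b. *)
Definition pair_products (gT : finGroupType) (b : seq gT) (k : nat) :
    {set gT} :=
  [set nth 1 b i.*2 * nth 1 b i.*2.+1 | i : 'I_k./2].

(* Main.v *)
Require Import Defs.
From mathcomp Require Import all_boot all_fingroup all_solvable.
From mathcomp Require Import zify.

(** Let w(G) be the sum of the numbers floor(m_i / 2) over the invariant
    factors m_i of G. The theorem rests on diam(G) = w(G) and on following the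
    case of equality through the proof of the upper bound.

    Upper bound. If a is a generator in A, every element of G is at distance at
    most floor(#[a] / 2) from an element that A reaches as quickly as its image
    is reached in G / <[a]>. By induction it suffices that
    floor(#[a] / 2) + w(G / <[a]>) <= w(G) ([weight_quotient]). To compare the
    types of G and G / <[a]>, choose c of maximal order both in G and modulo a
    ([max_order_pair]): then <[c]> splits off in both groups, and the claim
    for a is reduced to the claim for the image of a in G / <[c]> together with
    a numerical inequality on the cyclic orders involved ([half_transfer]).

    Equality. Suppose that some g0 is at distance w(G) from 1. Then all the
    inequalities above are equalities for every a in A, which forces the order
    of each nontrivial element of A to be an invariant factor of G (or to be 2
    when 4 is one). These orders are therefore totally ordered by divisibility, and some
    a in A has order the exponent of G ([extremal_exponent]). The image of A in
    G / <[a]> is again extremal, hence by induction it is, up to inverses, a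
    basis together with products of disjoint pairs of basis elements of
    order 3. It remains to see how A lies above its image. Far elements of a
    cyclic group of order m are very few: only a ^+ m./2 and its inverse are at
    distance m./2 from 1. Thus any two short words in A with the same image as
    the far element g0 differ very little, and this pins down the lifts: a lift
    of a basis element has the same order ([order_lift]); it is unique unless
    #[a] = 3 ([two_lifts]); a product of a pair lifts to the product of the
    lifts ([pair_lift]); and if #[a] = 3, at most one basis element has two
    lifts, which differ by a and so yield one new pair
    ([three_lifts], [two_double_lifts]).

    Converse. The generating sets of the theorem are unions of blocks lying in
    the factors of a direct decomposition, and distances add up over such
    factors ([far_dprod]). A cyclic block of order m has an element at distance
    m./2, and a block {x, y, x * y} in Z_3 + Z_3 does not reach x * y^-1 in one
    step ([far_pair]). Summing gives an element at distance w(G). *)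

Set Implicit Arguments.
Unset Strict Implicit.
Unset Printing Implicit Defensive.

Local Open Scope group_scope.

(** * Invariant factors and the weight of an abelian group *)

(** This turns out to be the diameter of G ([diamE]). *)
Definition weight (gT : finGroupType) (G : {group gT}) : nat :=
  \sum_(m <- abelian_type G) m./2.

Lemma abelian_typeE (gT : finGroupType) (G : {group gT}) (b : seq gT) :
    abelian G -> \big[dprod/1]_(x <- b) <[x]> = G ->
    all (ltn 1%N) (map order b) -> sorted [rel m n | n %| m] (map order b) ->
  abelian_type G = map order b.
Proof.
move=> cGG bG b1 sb; apply: (can_inj revK).
apply/(ab_typeP _ cGG); split; rewrite ?all_rev ?rev_sorted //.
exists (rev b); last by rewrite map_rev.
by rewrite -bG; apply: perm_big; rewrite perm_rev.
Qed.

(** A cyclic subgroup of order the exponent is a direct factor, and its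
    generator can head a basis. *)
Lemma abelian_type_cons (gT : finGroupType) (G : {group gT}) (c : gT) :
    abelian G -> G :!=: 1 -> c \in G -> #[c] = exponent G ->
  abelian_type G = #[c] :: abelian_type (G / <[c]>).
Proof.
move=> cGG ntG Gc oc.
case/splitsP: (abelian_splits Gc oc cGG) => K /complP[tiK defG].
have sKG : K \subset G by rewrite -defG mulG_subr.
have dG : <[c]> \x K = G.
  by rewrite dprodE // (sub_abelian_cent2 cGG) ?cycle_subG.
have isoK : K \isog G / <[c]> by exact: sdprod_isog (dprodWsd dG).
rewrite -(isog_abelian_type isoK).
have [b bK bt] := abelian_structure (abelianS sKG cGG).
rewrite (@abelian_typeE _ _ (c :: b)) //= ?bt //.
- by rewrite big_cons bK.
- have -> : all (ltn 1%N) (abelian_type K) by apply: abelian_type_gt1.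
  rewrite andbT oc ltn_neqAle eq_sym -dvdn1 -trivg_exponent ntG.
  exact: exponent_gt0.
rewrite path_min_sorted ?abelian_type_dvdn_sorted //.
rewrite -bt; apply/allP=> _ /mapP[x xb ->] /=; rewrite oc dvdn_exponent //.
apply: (subsetP sKG); rewrite -cycle_subG -(bigdprodWY bK).
by rewrite (big_rem x) //= joing_subl.
Qed.

Lemma isog_weight (gT rT : finGroupType) (G : {group gT}) (H : {group rT}) :
  G \isog H -> weight G = weight H.
Proof. by move=> isoGH; rewrite /weight (isog_abelian_type isoGH). Qed.

Lemma weight_cons (gT : finGroupType) (G : {group gT}) (c : gT) :
    abelian G -> c \in G -> #[c] = exponent G ->
  weight G = (#[c]./2 + weight (G / <[c]>))%N.
Proof.
move=> cGG Gc oc; have [G1|ntG] := eqVneq (G : {set gT}) 1; last first.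
  by rewrite /weight (abelian_type_cons cGG ntG Gc oc) // big_cons.
have c1 : c = 1 by apply/set1gP; rewrite -G1.
have -> : weight (G / <[c]>) = weight G; last by rewrite c1 order1.
by apply/esym/isog_weight; rewrite /= c1 cycle1 quotient1_isog.
Qed.

(** * Elements of maximal order in a group and a quotient *)

Lemma order_mul_p_elt (gT : finGroupType) (x y : gT) (p : nat) :
    prime p -> commute x y -> p.-elt x -> p.-elt y -> #[y] < #[x] ->
  #[x * y] = #[x].
Proof.
move=> p_pr cxy /p_natP[i oi] /p_natP[j oj] lt.
have p1 := prime_gt1 p_pr.
have lij : j < i by move: lt; rewrite oi oj ltn_exp2l.
apply/eqP; rewrite eqn_dvd; apply/andP; split.
  rewrite order_dvdn expgMn // expg_order mul1g -order_dvdn oi oj.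
  by rewrite dvdn_exp2l // ltnW.
have : #[x * y] %| (p ^ i)%N.
  rewrite order_dvdn expgMn // -oi expg_order mul1g -order_dvdn oi oj.
  by rewrite dvdn_exp2l // ltnW.
case/(dvdn_pfactor _ _ p_pr) => k lki ok; rewrite ok oi dvdn_exp2l //.
rewrite leqNgt; apply/negP=> ltki.
have : (x * y) ^+ (p ^ i.-1)%N == 1.
  by rewrite -order_dvdn ok dvdn_exp2l //; lia.
rewrite expgMn // => /eqP/(canRL (mulgK _)); rewrite mul1g.
have -> : y ^+ (p ^ i.-1)%N = 1.
  by apply/eqP; rewrite -order_dvdn oj dvdn_exp2l //; lia.
rewrite invg1 => /eqP; rewrite -order_dvdn oi dvdn_Pexp2l //; lia.
Qed.

Lemma partn_order_mul_constt (gT : finGroupType) (x y : gT) (p q : nat) :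
    commute x y -> p.-elt x ->
  (#[x * y.`_p^']`_q)%N = if q == p then #[x] else (#[y]`_q)%N.
Proof.
move=> cxy px.
have cp : coprime #[x] #[y.`_p^'].
  by rewrite (pnat_coprime px) // order_constt part_pnat.
rewrite orderM //; last by apply: commuteX.
rewrite order_constt partnM ?part_gt0 //; case: eqP => [->|/eqP qp].
  by rewrite part_pnat_id // part_p'nat ?muln1 // part_pnat.
rewrite (@part_p'nat q); last first.
  by apply: (sub_in_pnat _ px) => i _ /eqP->; rewrite !inE eq_sym.
rewrite mul1n -partnI; apply: eq_partn => i; rewrite !inE.
by case: (i =P q) => [->|]; rewrite ?andbF ?andbT.
Qed.

Lemma dvdn_eq_partn (m n : nat) : (0 < n)%N -> m %| n ->
  (forall p, p \in primes n -> (m`_p)%N = (n`_p)%N) -> m = n.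
Proof.
move=> n0 mn eqp; have m0 := dvdn_gt0 n0 mn.
apply: eqn_from_log => // p; have [ps|nps] := boolP (p \in primes n).
  by rewrite -(logn_part p m) (eqp p ps) (logn_part p n).
have [p_pr|np] := boolP (prime p); last first.
  by rewrite (lognE p m) (lognE p n) (negPf np).
have nd : ~~ (p %| n) by move: nps; rewrite mem_primes p_pr n0.
have md : ~~ (p %| m) by apply: contra nd => pm; apply: dvdn_trans pm mn.
by rewrite (lognE p m) (lognE p n) (negPf nd) (negPf md) !andbF.
Qed.

(** Non-maximal orders are detected one prime at a time. At a prime p, let
    the p-part of u have maximal order in G and that of v maximal order modulo
    H; then u, v or u * v is good for both, and the p-parts of good choices for
    the various p are multiplied together. *)
Lemma max_order_pair (gT : finGroupType) (G H : {group gT}) :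
    abelian G -> H \subset G ->
  exists2 c, c \in G &
    #[c] = exponent G /\ #[coset H c] = exponent (G / H).
Proof.
move=> cGG sHG.
have nHG : G \subset 'N(H) := sub_abelian_norm cGG sHG.
have nH x : x \in G -> x \in 'N(H) by apply: (subsetP nHG).
have cG x y : x \in G -> y \in G -> commute x y.
  by move=> Gx Gy; apply: (centsP cGG).
have [u Gu ou] := exponent_witness (abelian_nil cGG).
have [_ /morphimP[v Nv Gv ->] ov] :=
  exponent_witness (abelian_nil (quotient_abelian H cGG)).
have cstt p x : x \in G -> x.`_p \in G.
  by move=> Gx; rewrite groupX.
have cosM x y : x \in G -> y \in G ->
    coset H (x * y) = coset H x * coset H y.
  by move=> Gx Gy; rewrite morphM ?nH.
have coP (pi : nat_pred) x : x \in G -> coset H x.`_pi = (coset H x).`_pi.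
  by move=> Gx; rewrite morph_constt ?nH.
have goodp p : prime p -> exists2 x, x \in G & [/\ p.-elt x,
    #[x] = ((exponent G)`_p)%N & #[coset H x] = ((exponent (G / H))`_p)%N].
  move=> p_pr.
  pose x := u.`_p; pose y := v.`_p.
  have ox : #[x] = ((exponent G)`_p)%N by rewrite order_constt ou.
  have oy : #[coset H y] = ((exponent (G / H))`_p)%N.
    by rewrite coP // order_constt ov.
  have Gx : x \in G by apply: cstt.
  have Gy : y \in G by apply: cstt.
  have px : p.-elt x by apply: p_elt_constt.
  have py : p.-elt y by apply: p_elt_constt.
  have oyd : #[y] %| #[x].
    by rewrite !order_constt partn_dvd // -?ou ?exponent_gt0 ?dvdn_exponent.
  have oxd : #[coset H x] %| #[coset H y].
    rewrite !coP // !order_constt partn_dvd // -?ov ?exponent_gt0 //.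
    by rewrite dvdn_exponent // mem_quotient.
  have [eqx|nex] := eqVneq #[coset H x] #[coset H y].
    by exists x => //; rewrite eqx.
  have [eqy|ney] := eqVneq #[y] #[x].
    by exists y => //; rewrite eqy.
  have ltx : #[y] < #[x] by rewrite ltn_neqAle ney dvdn_leq.
  have lty : #[coset H x] < #[coset H y] by rewrite ltn_neqAle nex dvdn_leq.
  have oxy : #[x * y] = #[x].
    by apply: (@order_mul_p_elt _ _ _ p) => //; apply: cG.
  exists (x * y); rewrite ?groupM // /p_elt oxy; split => //.
  rewrite -oy cG // cosM //; 
  apply: (@order_mul_p_elt _ _ _ p); rewrite ?morph_p_elt ?nH //.
  by rewrite /commute -!cosM // cG.
have step (ps : seq nat) : exists2 c, c \in G & forall p, p \in ps -> prime p ->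
    (#[c]`_p)%N = ((exponent G)`_p)%N /\
    (#[coset H c]`_p)%N = ((exponent (G / H))`_p)%N.
  elim: ps => [|p ps [c Gc cP]]; first by exists 1.
  have [p_pr|np] := boolP (prime p); last first.
    exists c => // q; rewrite inE => /predU1P[->|qs]; last exact: cP.
    by rewrite (negPf np).
  have [x Gx [px ox ohx]] := goodp p p_pr.
  have Gc' : c.`_p^' \in G by rewrite groupX.
  exists (x * c.`_p^'); first by rewrite groupM.
  move=> q; rewrite inE => qs q_pr.
  rewrite cosM // coP // !partn_order_mul_constt ?morph_p_elt ?nH //; first last.
  - exact: cG.
  - by rewrite /commute -(cosM _ _ Gx Gc) -(cosM _ _ Gc Gx) (cG _ _ Gx Gc).
  case: (eqVneq q p) qs => [->|_ /= qs]; first by rewrite ox ohx.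
  exact: cP q qs q_pr.
have [c Gc cP] := step (primes (exponent G)).
have inps p : p \in primes (exponent (G / H)) -> p \in primes (exponent G).
  rewrite !mem_primes !exponent_gt0 /= => /andP[-> /dvdn_trans-> //].
  exact: exponent_quotient.
exists c => //.
split; apply: dvdn_eq_partn;
  rewrite ?exponent_gt0 ?dvdn_exponent ?mem_quotient //.
  by move=> p ps; have [//|] := cP p ps; move: ps; rewrite mem_primes => /andP[].
move=> p /inps ps; have [//|] := cP p ps; move: ps; rewrite mem_primes => /andP[].
all: by [].
Qed.

(** * The weight of a quotient by a cyclic subgroup *)

(** With q <= n, the sum q + d * n is at least d * q + n, the difference
    being (d - 1) * (n - q). Rounding the halves down can cancel a nonzero
    difference only if it is 1, that is, d = 2 and n = q + 1, and then q = 1 because q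
    divides n. This accidental case corresponds to the equal weights of Z_4 and
    Z_2 + Z_2. *)
Lemma half_transfer (q n d : nat) : (0 < n)%N -> (0 < d)%N -> q %| n ->
  ((d * q)./2 + n./2 <= q./2 + (d * n)./2
    ?= iff [|| d == 1%N, q == n | [&& q == 1%N, n == 2 & d == 2]])%N.
Proof.
move=> n0 d0 qn; have q0 := dvdn_gt0 n0 qn; have leqn := dvdn_leq n0 qn.
have [->|d1] := eqVneq d 1%N; first by rewrite !mul1n addnC; split; rewrite ?eqxx.
have [->|neqn] := eqVneq q n; first by rewrite addnC; split; rewrite ?eqxx.
have [[/eqP-> /eqP-> /eqP->]|ne] := @and3P (q == 1%N) (n == 2) (d == 2).
  by [].
have lt : ((d * q)./2 + n./2 < q./2 + (d * n)./2)%N; last first.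
  by split; [exact: ltnW | rewrite /= ltn_eqF].
have oq : odd n -> odd q.
  by case/dvdnP: qn => e ->; rewrite oddM => /andP[].
case: d d0 d1 ne => // -[|d] // _ _ ne.
have [e ne0] : exists e, n = (q + e.+1)%N by exists (n - q).-1; lia.
have ge : (d * e + d + e + 1 = d.+1 * e.+1)%N by rewrite mulSn !mulnS; lia.
have eP : (d.+2 * n + q = d.+2 * q + n + d.+1 * e.+1)%N.
  by rewrite ne0 mulnDr (mulSn d.+1 e.+1); lia.
have P2 : ~~ odd d -> ~~ odd n -> odd q -> (1 < d.+1 * e.+1)%N.
  move=> ed en oq'; rewrite -ge ltnNge; apply/negP => le1.
  have d2 : d = 0%N by lia.
  have e2 : e = 0%N by lia.
  have q1 : q = 1%N by move: qn; rewrite ne0 e2 dvdn_addr // dvdn1 => /eqP.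
  by case: ne; split; apply/eqP; rewrite ?d2 ?ne0 ?q1 ?e2.
have Pge : (0 < d.+1 * e.+1)%N by [].
have := (odd_double_half q, odd_double_half n,
  odd_double_half (d.+2 * n), odd_double_half (d.+2 * q)).
rewrite !oddM /= negbK -!mul2n.
move: oq P2 eP Pge {ge ne0}.
move: (d.+2 * n)%N (d.+2 * q)%N (d.+1 * e.+1)%N => X Y P.
move: (X./2) (Y./2) (q./2) (n./2) => x y q' n'.
case: (odd d) (odd q) (odd n) => [] [] [] /= oq P2 eP Pge [[[]]];
  try (have := P2 isT isT isT); try (have := oq isT);
  clear -eP Pge; lia.
Qed.

(** Let c have maximal order in G and modulo a, let k be the image of a
    modulo c and d = #[c] / #[a]. Counting <[a]> <*> <[c]> in two ways shows
    that c has order d * #[k] modulo a. So the bound for a differs from the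
    inductive bound for k in G / <[c]> only in that the orders d * #[a] of c and
    #[k] are replaced with #[a] and d * #[k]. Equality for a forces
    equality for k, and the cases of [half_transfer] mean that #[a] is #[c], or #[k], or
    is 2 with #[c] = 4. *)
Lemma weight_quotient (gT : finGroupType) (G : {group gT}) (a : gT) :
    abelian G -> a \in G ->
  (#[a]./2 + weight (G / <[a]>) <= weight G)%N /\
  (weight G = (#[a]./2 + weight (G / <[a]>))%N -> a != 1 ->
    #[a] \in abelian_type G \/ #[a] = 2%N /\ 4 \in abelian_type G).
Proof.
have [n] := ubnP #|G|; elim: n gT G a => // n IH gT G a leGn cGG Ga.
have [G1|ntG] := eqVneq (G : {set gT}) 1.
  have a1 : a = 1 by apply/set1gP; rewrite -G1.
  have e : weight (G / <[a]>) = weight G.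
    by apply/esym/isog_weight; rewrite /= a1 cycle1 quotient1_isog.
  by rewrite e a1 order1 eqxx.
have sAG : <[a]> \subset G by rewrite cycle_subG.
have [c Gc [oc oc']] := max_order_pair cGG sAG.
have sCG : <[c]> \subset G by rewrite cycle_subG.
have nC := sub_abelian_norm cGG sCG; have nA := sub_abelian_norm cGG sAG.
have nrm x y : x \in G -> y \in G -> x \in 'N(<[y]>).
  by move=> Gx Gy; apply: (subsetP (sub_abelian_norm cGG _)); rewrite ?cycle_subG.
pose k := coset <[c]> a; pose c' := coset <[a]> c.
have cG'G' := quotient_abelian <[c]> cGG.
have cG''G'' := quotient_abelian <[a]> cGG.
have G'k : k \in G / <[c]> by apply: mem_quotient.
have c1 : (1 < #[c])%N.
  by rewrite oc ltn_neqAle eq_sym -dvdn1 -trivg_exponent ntG exponent_gt0.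
have ltG' : (#|G / <[c]>| < n)%N.
  rewrite ltnS in leGn; apply: leq_trans leGn.
  by rewrite ltn_quotient // cycle_eq1 -order_gt1.
have wG := weight_cons cGG Gc oc.
have wG' : weight (G / <[a]>) = (#[c']./2 + weight (G / <[a]> / <[c']>))%N.
  by apply: weight_cons; rewrite ?mem_quotient.
have [IH1 IH2] := IH _ _ _ ltG' cG'G' G'k.
have isoq x y : x \in G -> y \in G ->
    (G / <[x]> / <[coset <[x]> y]>) \isog (G / (<[x]> <*> <[y]>)).
  move=> Gx Gy; rewrite -quotient_cycle ?nrm // -quotientYidl; last first.
    by rewrite cycle_subG nrm.
  apply: third_isog; rewrite ?joing_subl // -sub_abelian_normal //.
    by rewrite cycle_subG.
  by rewrite join_subG !cycle_subG Gx.
have iso2 : weight (G / <[c]> / <[k]>) = weight (G / <[a]> / <[c']>).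
  apply: isog_weight; apply: isog_trans (isoq c a Gc Ga) _.
  by rewrite isog_sym joingC; apply: isoq.
have ordM x y : x \in G -> y \in G ->
    (#|<[x]> <*> <[y]>| = #[x] * #[coset <[x]> y])%N.
  move=> Gx Gy; rewrite [#[coset _ _]]orderE -quotient_cycle ?nrm //.
  rewrite -quotientYidl ?cycle_subG ?nrm //.
  rewrite card_quotient ?Lagrange ?joing_subl //.
  by rewrite join_subG normG cycle_subG nrm.
have ordE : (#[c] * #[k] = #[a] * #[c'])%N by rewrite -!ordM // joingC.
have ka : #[k] %| #[a] by apply: morph_order; rewrite nrm.
have /dvdnP[d cd] : #[a] %| #[c] by rewrite oc dvdn_exponent.
have d0 : (0 < d)%N by move: c1; rewrite cd; case: (d).
have c'E : #[c'] = (d * #[k])%N.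
  apply/eqP; rewrite -(eqn_pmul2l (order_gt0 a)) -ordE cd.
  by apply/eqP; rewrite mulnA (mulnC d).
have tr := half_transfer (order_gt0 a) d0 ka; rewrite -cd -c'E in tr.
rewrite wG wG' -iso2.
have arith (a2 c'2 k2 c2 w1 w2 : nat) :
    (k2 + w2 <= w1)%N -> (c'2 + a2 <= k2 + c2)%N ->
  (a2 + (c'2 + w2) <= c2 + w1)%N /\
  (c2 + w1 = a2 + (c'2 + w2) -> c'2 + a2 == k2 + c2 /\ w1 = k2 + w2)%N.
  by clear; move=> le1 le2; split=> [|e]; [|split]; lia.
have [le e12] := arith _ _ _ _ _ _ IH1 tr.1; split=> // /e12[e1 e2] an1.
rewrite (abelian_type_cons cGG ntG Gc oc) !inE.
move: e1; rewrite tr => /or3P[/eqP d1|/eqP kn|/and3P[_ /eqP a2 /eqP d2]].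
- by left; rewrite cd d1 mul1n eqxx.
- have kn1 : k != 1 by rewrite -order_gt1 kn order_gt1.
  rewrite -kn; have [->|[-> ->]] := IH2 e2 kn1; first by left; rewrite orbT.
  by right; rewrite orbT.
by right; rewrite cd a2 d2.
Qed.

(** * Balls and the upper bound for diameters *)

Section Balls.
Variable gT : finGroupType.
Implicit Types (A : {set gT}) (x y : gT) (i j n : nat) (G H : {group gT}).

Lemma mem_sym A x : (x \in sym A) = [|| x == 1, x \in A | x^-1 \in A].
Proof.
by rewrite !inE; case: (x == 1); case: (x \in A); case: (_ \in A).
Qed.

Lemma sym1 A : 1 \in sym A. Proof. by rewrite mem_sym eqxx. Qed.

Lemma symV A x : (x^-1 \in sym A) = (x \in sym A).
Proof. by rewrite !mem_sym invgK eq_invg1; congr (_ || _); rewrite orbC. Qed.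

Lemma sub_sym A : A \subset sym A.
Proof. exact: subsetUr. Qed.

Lemma sym_subG A G : (sym A \subset G) = (A \subset G).
Proof.
apply/idP/idP; first exact: subset_trans (sub_sym A).
by move=> sAG; rewrite /sym !subUset sAG sub1G -[gval G]invGid invSg sAG.
Qed.

Lemma gen_sym A : <<sym A>> = <<A>>.
Proof.
apply/eqP; rewrite eqEsubset andbC genS ?sub_sym // gen_subG.
by rewrite sym_subG subset_gen.
Qed.

Lemma ball0 A x : (x \in ball A 0) = (x == 1).
Proof. by rewrite /ball expg0 !inE. Qed.

Lemma ball1 A : ball A 1 = sym A. Proof. by rewrite /ball expg1. Qed.

Lemma ballM A i j x y : x \in ball A i -> y \in ball A j ->
  x * y \in ball A (i + j).
Proof. by move=> xi yj; rewrite /ball expgD mem_mulg. Qed.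

Lemma ball_one A n : 1 \in ball A n.
Proof.
elim: n => [|n IH]; first by rewrite ball0.
by rewrite -[1]mulg1 (@ballM A 1 n) // ball1 sym1.
Qed.

Lemma ball_leq A i j x : (i <= j)%N -> x \in ball A i -> x \in ball A j.
Proof.
by move=> le xi; rewrite -(subnKC le) -[x]mulg1 ballM // ball_one.
Qed.

Lemma ballX A n x : x \in sym A -> x ^+ n \in ball A n.
Proof.
move=> sx; elim: n => [|n IH]; first by rewrite expg0 ball_one.
by rewrite expgS (@ballM A 1 n) // ball1.
Qed.

Lemma ballV A n x : (x^-1 \in ball A n) = (x \in ball A n).
Proof.
suffices imp y : y \in ball A n -> y^-1 \in ball A n.
  by apply/idP/idP => /imp //; rewrite invgK.
elim: n y => [|n IH] y; first by rewrite !ball0 eq_invg1.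
rewrite {1}/ball expgSr => /mulsgP[z s zn ss ->].
by rewrite invMg; apply: (@ballM A 1 n); rewrite ?IH // ball1 symV.
Qed.

Lemma ball_sub A G n : A \subset G -> ball A n \subset G.
Proof.
rewrite -sym_subG => sSG; elim: n => [|n IH]; first by rewrite sub1G.
by rewrite /ball expgS mul_subG.
Qed.

Lemma ballS A B n : sym A \subset sym B -> ball A n \subset ball B n.
Proof.
move=> sAB; elim: n => [|n IH]; first by rewrite /ball !expg0.
by rewrite /ball !expgS mulgSS.
Qed.

(** Either the exponent or its complement to #[a] is at most #[a] / 2. *)
Lemma cycle_ball A a x : a \in sym A -> x \in <[a]> -> x \in ball A #[a]./2.
Proof.
move=> sa /cyclePmin[i lti ->].
have [le|lt] := leqP i #[a]./2; first by apply: ball_leq le _; apply: ballX.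
have -> : a ^+ i = (a ^+ (#[a] - i))^-1.
  by apply/eqP; rewrite eq_mulgV1 invgK -expgD -order_dvdn subnKC // ltnW.
rewrite ballV; apply: (@ball_leq _ (#[a] - i)); last exact: ballX.
by move: lt lti; clear; lia.
Qed.

Section Quotient.
Variables (A : {set gT}) (G H : {group gT}).
Hypotheses (cGG : abelian G) (sAG : A \subset G) (sHG : H \subset G).

Let nHG : G \subset 'N(H) := sub_abelian_norm cGG sHG.

Lemma sym_quotient : sym A / H = sym (A / H).
Proof. by rewrite /sym !quotientU quotientV quotient1. Qed.

Lemma ball_quotient n : ball A n / H = ball (A / H) n.
Proof.
elim: n => [|n IH]; first by rewrite /ball !expg0 quotient1.
rewrite /ball !expgS quotientMl ?sym_quotient; first by congr (_ * _).
by apply: subset_trans nHG; rewrite sym_subG.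
Qed.

Lemma coset_ball n x : x \in ball A n -> coset H x \in ball (A / H) n.
Proof.
move=> xn; rewrite -ball_quotient; apply: mem_morphim => //.
exact: subsetP nHG _ (subsetP (ball_sub n sAG) _ xn).
Qed.

Lemma ball_lift n (z : coset_of H) : z \in ball (A / H) n ->
  exists2 x, x \in ball A n & coset H x = z.
Proof. by rewrite -ball_quotient => /morphimP[x _ xn ->]; exists x. Qed.

Lemma coset_eq x y : x \in G -> y \in G -> coset H x = coset H y ->
  x^-1 * y \in H.
Proof.
move=> Gx Gy eq; apply: coset_idr; first by rewrite (subsetP nHG) ?groupM ?groupV.
by rewrite morphM ?morphV ?(subsetP nHG) ?groupV //= -eq mulVg.
Qed.

Lemma ball_extension i j :
    H \subset ball A i -> G / H \subset ball (A / H) j ->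
  G \subset ball A (i + j).
Proof.
move=> sHi sGj; apply/subsetP=> g Gg.
have [x xj eq] := ball_lift (subsetP sGj _ (mem_quotient H Gg)).
have Gx := subsetP (ball_sub j sAG) _ xj.
rewrite -(mulKVg x g) addnC ballM // (subsetP sHi) //.
exact: coset_eq.
Qed.

End Quotient.

End Balls.

(** The upper bound for all diameters: peel off one generator at a time. *)
Lemma sub_ball_weight (gT : finGroupType) (G : {group gT}) (A : {set gT}) :
  abelian G -> <<A>> = G -> G \subset ball A (weight G).
Proof.
have [n] := ubnP #|G|; elim: n gT G A => // n IH gT G A leGn cGG genA.
have sAG : A \subset G by rewrite -genA subset_gen.
have [sA1|/subsetPn[a Aa an1]] := boolP (A \subset [1 gT]).
  have sG1 : G \subset [1 gT] by rewrite -genA gen_subG.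
  by apply: subset_trans sG1 _; rewrite sub1set ball_one.
have Ga := subsetP sAG _ Aa; have sHG : <[a]> \subset G by rewrite cycle_subG.
have [le _] := weight_quotient cGG Ga.
have sGb : G \subset ball A (#[a]./2 + weight (G / <[a]>)).
  apply: (ball_extension cGG sAG sHG).
    by apply/subsetP=> x; apply: cycle_ball; apply: (subsetP (sub_sym A)).
  apply: IH; rewrite ?quotient_abelian //.
    rewrite ltnS in leGn; apply: leq_trans leGn.
    by rewrite ltn_quotient // cycle_eq1; move: an1; rewrite inE.
  rewrite /= -quotient_gen ?genA //.
  exact: subset_trans sAG (sub_abelian_norm cGG sHG).
by apply/subsetP=> x /(subsetP sGb); apply: ball_leq.
Qed.

(** * Elements far from the identity *)

Definition far (gT : finGroupType) (A : {set gT}) (n : nat) (g : gT) :=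
  forall k, g \in ball A k -> (n <= k)%N.

Section Far.
Variable gT : finGroupType.
Implicit Types (A : {set gT}) (x y g : gT) (n k : nat).

Lemma farV A n g : far A n g -> far A n g^-1.
Proof. by move=> fg k; rewrite ballV; apply: fg. Qed.

Lemma far_mulr A n k w g :
  w \in ball A k -> far A n g -> far A (n - k) (w^-1 * g).
Proof.
by move=> wk fg j gj; rewrite leq_subLR -[g](mulKVg w) in fg *; apply/fg/ballM.
Qed.

Lemma far_leq A n k g : (n <= k)%N -> far A k g -> far A n g.
Proof. by move=> le fg j /fg; apply: leq_trans. Qed.

Lemma bigdprod_ball A (b : seq gT) (K : {group gT}) :
    \big[dprod/1]_(x <- b) <[x]> = K -> {subset b <= sym A} ->
  K \subset ball A (\sum_(x <- b) #[x]./2).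
Proof.
elim: b K => [|x b IH] K.
  by rewrite !big_nil => <- _; rewrite sub1set ball0.
rewrite !big_cons; case/dprodP=> [[_ L _ defL] <- _ _] sbA.
rewrite /ball expgD mulgSS //.
  by apply/subsetP=> y; apply: cycle_ball; apply: sbA; rewrite mem_head.
by rewrite defL; apply: IH => // y yb; apply: sbA; rewrite inE yb orbT.
Qed.

End Far.

(** * Lifting generators from the quotient by a cyclic subgroup *)

Section Localization.
Variables (gT : finGroupType) (G : {group gT}) (A : {set gT}) (a : gT).
Hypotheses (cGG : abelian G) (sAG : A \subset G) (sa : a \in sym A).
Variables (b : seq (coset_of <[a]>)) (g0 : gT).
Hypotheses (defb : \big[dprod/1]_(x <- b) <[x]> = G / <[a]>).
Hypotheses (sb : {subset b <= sym (A / <[a]>)}) (Gg0 : g0 \in G).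
Hypothesis fg0 : far A (#[a]./2 + \sum_(x <- b) #[x]./2) g0.
Hypothesis oa : #[a] = exponent G.

Let Ga : a \in G. Proof. by apply: subsetP sa; rewrite sym_subG. Qed.
Let sHG : <[a]> \subset G. Proof. by rewrite cycle_subG. Qed.
Let nHG : G \subset 'N(<[a]>) := sub_abelian_norm cGG sHG.
Let cG x y : x \in G -> y \in G -> x * y = y * x.
Proof. by move=> Gx Gy; apply: (centsP cGG). Qed.
Let sG x : x \in sym A -> x \in G.
Proof. by apply/subsetP; rewrite sym_subG. Qed.
Let bG k x : x \in ball A k -> x \in G.
Proof. exact: (subsetP (ball_sub k sAG)). Qed.
Let aG z : z \in <[a]> -> z \in G. Proof. exact: (subsetP sHG). Qed.

Let cosM x y : x \in G -> y \in G ->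
  coset <[a]> (x * y) = coset <[a]> x * coset <[a]> y.
Proof. by move=> Gx Gy; rewrite morphM ?(subsetP nHG). Qed.
Let cosV x : x \in G -> coset <[a]> x^-1 = (coset <[a]> x)^-1.
Proof. by move=> Gx; rewrite morphV ?(subsetP nHG). Qed.
Let cosX x n : x \in G -> coset <[a]> (x ^+ n) = coset <[a]> x ^+ n.
Proof. by move=> Gx; rewrite morphX ?(subsetP nHG). Qed.

Lemma far_exp n i : (i <= #[a])%N -> far A n (a ^+ i) ->
  (n <= i)%N /\ (n <= #[a] - i)%N.
Proof.
move=> le fi; split; first by apply: fi; apply: ballX.
apply: fi; rewrite -ballV (_ : _^-1 = a ^+ (#[a] - i)) ?ballX //.
apply/eqP; rewrite eq_invg_mul -expgD -order_dvdn subnKC //.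
Qed.

Lemma far_half z : z \in <[a]> -> far A #[a]./2 z ->
  z = a ^+ #[a]./2 \/ z = a ^- #[a]./2.
Proof.
case/cyclePmin=> i lti -> /far_exp[|le1 le2]; first exact: ltnW.
have [->|ne] := eqVneq i #[a]./2; [by left | right].
have -> : i = (#[a] - #[a]./2)%N by move: lti le1 le2 ne; clear; lia.
apply/eqP; rewrite eq_sym eq_invg_mul -expgD -order_dvdn subnKC //.
by clear; lia.
Qed.

Lemma half_cycleV : ~~ odd #[a] -> a ^+ #[a]./2 = a ^- #[a]./2.
Proof.
move=> ea; apply/eqP; rewrite eq_sym eq_invg_mul -expgD addnn -order_dvdn.
by rewrite even_halfK.
Qed.

Lemma half_cycleD : odd #[a] -> a ^+ #[a]./2 * a ^+ #[a]./2 = a^-1.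
Proof.
move=> ea; apply/eqP; rewrite eq_sym eq_invg_mul -expgD -expgS addnn.
rewrite -order_dvdn (_ : _.+1 = #[a]) //.
by rewrite -[RHS]odd_double_half ea.
Qed.

(** The only candidates a ^+ #[a]./2 and a ^- #[a]./2 coincide for even #[a],
    and they are neighbours for odd #[a]. *)
Lemma far_half2 z u : z \in <[a]> -> u \in <[a]> -> u != 1 ->
    far A #[a]./2 z -> far A #[a]./2 (u * z) ->
  odd #[a] /\ (z = a ^+ #[a]./2 /\ u = a \/ z = a ^- #[a]./2 /\ u = a^-1).
Proof.
move=> az au u1 /(far_half az) zE /(far_half (groupM au az)) uzE.
have ne : u * z != z by rewrite eq_mulgV1 mulgK.
have oa2 : odd #[a].
  apply: contraLR u1 => /half_cycleV eV; move: ne.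
  by case: zE uzE => -> [] ->; rewrite -?eV ?eqxx.
split=> //; have e := half_cycleD oa2.
case: zE uzE ne => -> [] eq; rewrite eq ?eqxx // => _.
  left; split=> //; rewrite -[u](mulgK (a ^+ #[a]./2)) eq -invMg e.
  by rewrite invgK.
right; split=> //; rewrite -[u](mulgK (a ^- #[a]./2)) eq invgK e //.
Qed.

Lemma odd_cycle_sqr u : odd #[a] -> u \in <[a]> -> u ^+ 2 = 1 -> u = 1.
Proof.
rewrite -coprime2n => /eqP co au /eqP; rewrite -order_dvdn => d2; apply/eqP.
by rewrite -order_eq1 -dvdn1 -co dvdn_gcd d2 order_dvdG.
Qed.

(** If u != 1, the elements z, u * z and u^-1 * z are distinct, unless u is an
    involution and #[a] is even; but <[a]> has at most two elements at distance
    #[a] / 2, and only one if #[a] is even. *)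
Lemma far_half3 z u : z \in <[a]> -> u \in <[a]> ->
    far A #[a]./2 z -> far A #[a]./2 (u * z) -> far A #[a]./2 (u^-1 * z) ->
  u = 1.
Proof.
move=> az au fz fuz fvz; apply/eqP; apply: contraTT isT => u1.
have u'1 : u^-1 != 1 by rewrite eq_invg1.
have [odda E1] := far_half2 az au u1 fz fuz.
have [_ E2] := far_half2 az (groupVr au) u'1 fz fvz.
case/negP: u1; apply/eqP/(odd_cycle_sqr odda au).
have aa : a ^+ #[a]./2 = a ^- #[a]./2 -> a = a^-1.
  move=> e; have a1 : a^-1 = 1 by rewrite -(half_cycleD odda) {1}e mulVg.
  by rewrite a1 -[LHS]invgK a1 invg1.
have uuV : u = u^-1; last by rewrite expgS expg1 {1}uuV mulVg.
case: E1 E2 => [[e1 eu]|[e1 eu]] [[e2 eu']|[e2 eu']]; rewrite eu' eu //.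
  by apply: aa; rewrite -e2 e1.
by apply/esym/aa; rewrite -e1 e2.
Qed.


(** Dividing the far element g0 by a word that realizes the coordinates of its
    image outside l leaves an element over the factors in l alone, still as far
    away as possible. *)
Lemma localize (l r : seq (coset_of <[a]>)) : perm_eq b (l ++ r) ->
  exists g, exists L : {group coset_of <[a]>},
    [/\ g \in G, far A (#[a]./2 + \sum_(x <- l) #[x]./2) g,
        \big[dprod/1]_(x <- l) <[x]> = L & coset <[a]> g \in L].
Proof.
move=> blr; move: defb fg0; rewrite (perm_big _ blr) big_cat /=.
rewrite [\sum_(x <- b) _](perm_big _ blr) big_cat /=.
case/dprodP=> [[L R defL defR]]; rewrite defL defR => defLR _ _ fg.
have sr : {subset r <= sym (A / <[a]>)}.
  by move=> x xr; rewrite sb // (perm_mem blr) mem_cat xr orbT.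
have: coset <[a]> g0 \in L * R by rewrite defLR mem_quotient.
case/mulsgP=> u v Lu Rv g0E.
have [w wr wv] := ball_lift cGG sAG sHG (subsetP (bigdprod_ball defR sr) _ Rv).
exists (w^-1 * g0), L; split=> //; first by rewrite groupM ?groupV // (bG wr).
  by apply: far_leq (far_mulr wr fg); rewrite addnA addnK.
have cuv : v * u = u * v.
  apply: (centsP (quotient_abelian <[a]> cGG)).
    by rewrite -defLR (subsetP (mulG_subr _ _)).
  by rewrite -defLR (subsetP (mulG_subl _ _)).
by rewrite cosM ?groupV ?(bG wr) // cosV ?(bG wr) // wv g0E -cuv mulKg.
Qed.

(** A word w over the image of g differs from g by an element of <[a]>, whose
    distance is at most #[a] / 2: w is therefore not too short, and if it is of
    minimal length the difference is as far as possible in <[a]>. *)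
Lemma far_coset n k w g : g \in G -> far A (#[a]./2 + n) g -> w \in ball A k ->
    coset <[a]> w = coset <[a]> g ->
  [/\ w^-1 * g \in <[a]>, far A (#[a]./2 + n - k) (w^-1 * g) & (n <= k)%N].
Proof.
move=> Gg fg wk eq; have aw := coset_eq cGG sHG (bG wk) Gg eq.
have fw := far_mulr wk fg; split=> //.
by have := fw _ (cycle_ball sa aw); clear; lia.
Qed.

Lemma far_coset_eq k w g : g \in G -> far A (#[a]./2 + k) g -> w \in ball A k ->
    coset <[a]> w = coset <[a]> g ->
  w^-1 * g \in <[a]> /\ far A #[a]./2 (w^-1 * g).
Proof.
move=> Gg fg wk eq; have [aw fw _] := far_coset Gg fg wk eq.
by rewrite addnK in fw.
Qed.

(** Another power of a in the generating set would give a short cut to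
    a ^+ #[a]./2. *)
Lemma sym_cycle s : s \in sym A -> s \in <[a]> -> [\/ s = 1, s = a | s = a^-1].
Proof.
move=> ss as_.
have [g [L [Gg]]] := localize (perm_refl b : perm_eq b ([::] ++ b)).
rewrite !big_nil addn0 => fg <- /set1P g1.
have ag : g \in <[a]> by apply: coset_idr g1; rewrite (subsetP nHG).
have fh : far A #[a]./2 (a ^+ #[a]./2).
  by have [<-//|e] := far_half ag fg; rewrite -[_ ^+ _]invgK -e; apply: farV.
have key t c : t \in sym A -> t = a ^+ c -> (c <= #[a]./2)%N -> (c <= 1)%N.
  move=> st tE le; have := fh (1 + (#[a]./2 - c))%N.
  rewrite -{1}(subnKC le) expgD.
  rewrite -tE ballM ?ballX ?ball1 // => /(_ isT); move: le; clear; lia.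
have [i lti sE] := cyclePmin as_.
have [le|lt] := leqP i #[a]./2.
  have i1 := key _ _ ss sE le; case: i i1 sE {lti le} => [|[|i]] // _ ->.
    by apply: Or31.
  by apply: Or32.
have tE : s^-1 = a ^+ (#[a] - i).
  by apply/eqP; rewrite sE eq_invg_mul -expgD -order_dvdn subnKC // ltnW.
have le : (#[a] - i <= #[a]./2)%N by move: lt; clear; lia.
have i1 : (#[a] - i = 1)%N.
  by have := key _ _ (etrans (symV A s) ss) tE le; move: lti; clear; lia.
by apply: Or33; rewrite -[s]invgK tE i1.
Qed.

(** A coordinate closer to 0 modulo #[x] would make the element too close to 1,
    which leaves only #[x]./2 up to inversion. *)
Lemma localize1 x (r : seq (coset_of <[a]>)) : perm_eq b (x :: r) ->
  exists g, [/\ g \in G, far A (#[a]./2 + #[x]./2) g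
    & coset <[a]> g = x ^+ #[x]./2].
Proof.
move=> bxr; have [g [L [Gg]]] := @localize [:: x] r bxr.
rewrite !big_seq1 => fg <- /cyclePmin[i lti gE].
have [c sc cx] : exists2 c, c \in sym A & coset <[a]> c = x.
  have : x \in sym (A / <[a]>) by rewrite sb // (perm_mem bxr) mem_head.
  by rewrite -!ball1 => /(ball_lift cGG sAG sHG).
have Gc := sG sc.
have key g' j : g' \in G -> far A (#[a]./2 + #[x]./2) g' ->
    coset <[a]> g' = x ^+ j -> (#[x]./2 <= j)%N.
  move=> Gg' fg' g'E; have := far_coset Gg' fg' (ballX j sc).
  by rewrite cosX // cx g'E => /(_ (erefl _))[].
have lei := key _ _ Gg fg gE.
have gVE : coset <[a]> g^-1 = x ^+ (#[x] - i).
  apply/eqP; rewrite cosV // gE eq_invg_mul -expgD -order_dvdn subnKC //.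
  exact: ltnW.
have leVi := key _ _ (groupVr Gg) (farV fg) gVE.
have [e|ne] := eqVneq i #[x]./2; first by exists g; rewrite gE e.
exists g^-1; rewrite groupV gVE; split=> //; first exact: farV.
by congr (_ ^+ _); move: lei leVi lti ne; clear; lia.
Qed.

(** Put n = #[x]. The words c ^+ n./2 and c ^- (n - n./2) have the same image
    and differ by c ^+ n, an element of <[a]> whose exponent is a multiple of n
    since the order of c divides #[a]. If n is even then so is #[a], both words
    are minimal, and they must agree. If n is odd the second word is longer by one,
    which allows a difference of a few steps in <[a]>, but no multiple of
    n >= 3. *)
Lemma order_lift x (r : seq (coset_of <[a]>)) c : perm_eq b (x :: r) ->
    (1 < #[x])%N -> c \in sym A -> coset <[a]> c = x ->
  #[c] = #[x].
Proof.
move=> bxr x1 sc cx; have Gc := sG sc.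
have [g [Gg fg gE]] := localize1 bxr.
set n := #[x] in fg gE *.
have hn : (n./2 <= n)%N by rewrite -{2}[n]odd_double_half -addnn addnA leq_addl.
have nc : n %| #[c] by rewrite /n -cx morph_order ?(subsetP nHG).
apply/eqP; rewrite eqn_dvd nc andbT order_dvdn.
have at_ : c ^+ n \in <[a]>.
  by apply: coset_idr; rewrite ?(subsetP nHG) ?groupX // cosX // cx expg_order.
have cg : coset <[a]> (c ^+ n./2) = coset <[a]> g by rewrite cosX // cx gE.
have [az fz] := far_coset_eq Gg fg (ballX n./2 sc) cg.
set z := _ * g in az fz.
have nm : n %| #[a].
  rewrite oa; apply: dvdn_trans (exponent_quotient G <[a]>).
  by rewrite dvdn_exponent // -cx mem_quotient.
have wB : c ^- (n - n./2) \in ball A (n - n./2) by rewrite ballV ballX.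
have wE : coset <[a]> (c ^- (n - n./2)) = coset <[a]> g.
  apply/eqP; rewrite cosV ?groupX // cosX // cx gE eq_invg_mul -expgD.
  by rewrite -order_dvdn subnK.
have [_] := far_coset Gg fg wB wE.
have -> : (c ^- (n - n./2))^-1 * g = c ^+ n * z.
  rewrite invgK /z mulgA; congr (_ * g).
  by apply: (canRL (mulgK _)); rewrite -expgD subnK.
move=> fcz _; have [en|on] := boolP (odd n); last first.
  have ea : ~~ odd #[a] by apply: contra on => /(dvdn_odd nm).
  have e1 : (#[a]./2 + n./2 - (n - n./2) = #[a]./2)%N.
    by rewrite -{2}(even_halfK on); clear; lia.
  rewrite e1 in fcz.
  by apply: contraNT ea => c1; have [] := far_half2 az at_ c1 fz fcz.
have e1 : (#[a]./2 + n./2 - (n - n./2) = #[a]./2 - 1)%N.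
  by have := odd_double_half n; rewrite en; clear; lia.
rewrite e1 in fcz.
have [j ltj jE] := cyclePmin at_.
have nj : n %| j.
  have [q qE] := dvdnP nm.
  have q0 : (0 < q)%N by move: (order_gt0 a); rewrite qE; case: (q).
  rewrite -(dvdn_pmul2l q0) -qE order_dvdn mulnC expgM -jE -expgM mulnC -qE.
  by rewrite oa expg_exponent.
have [j0|j0] := posnP j; first by rewrite jE j0.
have n3 : (3 <= n)%N.
  by move: x1 en; rewrite -/n; case: (n) => [|[|[|]]].
have nlej : (3 <= j)%N by apply: leq_trans n3 (dvdn_leq j0 nj).
have nlemj : (3 <= #[a] - j)%N.
  by apply: leq_trans n3 (dvdn_leq _ (dvdn_sub nm nj)); rewrite subn_gt0.
exfalso.
(* Addition of exponents modulo #[a], with values between 0 and #[a]. *)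
have wrap i : (i <= #[a])%N -> a ^+ j * a ^+ i =
    a ^+ (if (j + i <= #[a])%N then j + i else j + i - #[a]).
  move=> lei; rewrite -expgD; case: leqP => // lt.
  by rewrite -{1}(subnK (ltnW lt)) expgD expg_order mulg1.
have zE : exists2 i, (i <= #[a])%N &
    z = a ^+ i /\ (i = #[a]./2 \/ i = #[a] - #[a]./2)%N.
  have [->|->] := far_half az fz.
    by exists #[a]./2; [clear; lia | split=> //; left].
  exists (#[a] - #[a]./2)%N; first by clear; lia.
  split; last by right.
  apply/eqP; rewrite eq_invg_mul -expgD -order_dvdn subnKC //; clear; lia.
have [i lei [ziE iE]] := zE.
move: fcz; rewrite jE ziE wrap // => /far_exp.
move: lei iE ltj nlej nlemj; clear; case: ifP; lia.
Qed.

Let sb1 s : s \in sym A -> s \in ball A 1. Proof. by rewrite ball1. Qed.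

(** Write c' = c * u. Exchanging c for c' in the word c ^+ #[x]./2 once gives
    two far elements of <[a]>, so #[a] is odd and u is a or its inverse;
    exchanging it twice would give a third one, so #[x] = 3. Then the word
    c' ^- 2 of length 2, which moves by u twice in the other direction, is a
    short cut as soon as #[a] > 3. *)
Lemma two_lifts x (r : seq (coset_of <[a]>)) c c' : perm_eq b (x :: r) ->
    (1 < #[x])%N -> c \in sym A -> c' \in sym A ->
    coset <[a]> c = x -> coset <[a]> c' = x -> c' != c ->
  #[a] = 3.
Proof.
move=> bxr x1 sc sc' cx c'x ne; have [Gc Gc'] := (sG sc, sG sc').
pose u := c^-1 * c'.
have c'E : c' = c * u by rewrite mulKVg.
have au : u \in <[a]> by apply: (coset_eq cGG sHG); rewrite ?c'x.
have u1 : u^-1 != 1 by rewrite eq_invg1 -eq_mulVg1 eq_sym.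
have [g [Gg fg gE]] := localize1 bxr.
have [Gu GuV] := (aG au, aG (groupVr au)).
have k0 : (0 < #[x]./2)%N by rewrite half_gt0.
(* Trading letters c for other words over x keeps c ^+ #[x]./2 minimal. *)
have pw j w : (j <= #[x]./2)%N -> w \in ball A j -> coset <[a]> w = x ^+ j ->
    let w' := c ^+ (#[x]./2 - j) * w in
    w'^-1 * g \in <[a]> /\ far A #[a]./2 (w'^-1 * g).
  move=> lej wj wE /=; apply: (far_coset_eq Gg fg).
    by rewrite -{2}(subnK lej) ballM ?ballX.
  by rewrite cosM ?groupX ?(bG wj) // cosX // cx wE gE -expgD subnK.
have [az fz] : (c ^+ #[x]./2)^-1 * g \in <[a]> /\
    far A #[a]./2 ((c ^+ #[x]./2)^-1 * g).
  have := pw 0 1 isT; rewrite ball0 subn0 mulg1 expg0 coset_id ?group1 //.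
  by apply.
set z := _ * g in az fz.
have cc : c' * c' = c ^+ 2 * u ^+ 2.
  by rewrite c'E -(expgMn 2 (cG Gc Gu)) expgS expg1.
have z1E : (c ^+ (#[x]./2 - 1) * c')^-1 * g = u^-1 * z.
  rewrite c'E mulgA -expgSr subn1 prednK // invMg -mulgA; congr (_ * _).
have [_ fz1] := pw 1%N c' k0 (sb1 sc') c'x.
rewrite /= z1E in fz1.
have [odda dich] := far_half2 az (groupVr au) u1 fz fz1.
have x3 : #[x] = 3.
  have xm : #[x] %| #[a].
    rewrite oa; apply: dvdn_trans (exponent_quotient G <[a]>).
    by rewrite dvdn_exponent // -cx mem_quotient.
  have oddx : odd #[x] := dvdn_odd xm odda.
  have [lt|] := ltnP #[x] 5.
    by move: x1 lt oddx; case: #[x] => [|[|[|[|[|]]]]].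
  move=> x5; have k2 : (2 <= #[x]./2)%N by rewrite -[2%N]/(5./2) half_leq.
  have cc2 : c' * c' \in ball A 2 by apply: (@ballM _ A 1 1); apply: sb1.
  have ccx : coset <[a]> (c' * c') = x ^+ 2 by rewrite cosM // c'x.
  have [_ fz2] := pw 2 (c' * c') k2 cc2 ccx.
  have z2E : (c ^+ (#[x]./2 - 2) * (c' * c'))^-1 * g = u^-1 * (u^-1 * z).
    rewrite cc mulgA -expgD subnK // invMg -mulgA.
    by rewrite {1}expgS expg1 invMg /z !mulgA.
  rewrite /= z2E in fz2; case/eqP: u1; apply/eqP; rewrite eq_invg1; apply/eqP.
  apply: (far_half3 (groupM (groupVr au) az) au fz1 _ fz2).
  by rewrite mulKVg.
have c3 : c ^+ 3 = 1 by rewrite -x3 -(order_lift bxr x1 sc cx) expg_order.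
have m3 : 3 %| #[a].
  rewrite oa; apply: dvdn_trans (exponent_quotient G <[a]>).
  by rewrite -x3 dvdn_exponent // -cx mem_quotient.
have [lt|h2] := ltnP #[a]./2 2.
  move: m3 odda lt (order_gt0 a); case: #[a] => [|[|[|[|[|n]]]]] //.
have zE : z = c^-1 * g by rewrite /z x3 expg1.
exfalso; rewrite x3 /= in gE fg.
have wB : c'^-1 * c'^-1 \in ball A 2.
  by apply: (@ballM _ A 1 1); rewrite ball1 symV.
have wE : coset <[a]> (c'^-1 * c'^-1) = coset <[a]> g.
  rewrite cosM ?groupV // cosV // c'x gE; apply/eqP.
  by rewrite -invMg eq_invg_mul expg1 -mulgA -[Y in _ == Y](expg_order x) x3.
have wg : (c'^-1 * c'^-1)^-1 * g = u * (u * z).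
  have -> : z = c ^+ 2 * g.
    by rewrite zE; congr (_ * _); apply/eqP; rewrite eq_invg_mul -expgS c3.
  rewrite invMg invgK cc (cG (groupX 2 Gc) (groupX 2 Gu)).
  by rewrite {1}expgS expg1 !mulgA.
have [_] := far_coset Gg fg wB wE; rewrite wg => fz2 _.
have : (#[a]./2 + 1 - 2 <= #[a]./2 - 2)%N; last by move: h2; clear; lia.
have aE : a^-1 * (a^-1 * a ^+ #[a]./2) = a ^+ (#[a]./2 - 2).
  by rewrite -{1}(subnKC h2) !expgS !mulKg.
apply: fz2; case: dich => [[-> uE]|[-> uE]].
  by rewrite -[u]invgK uE aE ballX.
rewrite -[u]invgK uE invgK -ballV !invMg !invgK -!mulgA.
have -> : a ^+ #[a]./2 * (a^-1 * a^-1) = a^-1 * (a^-1 * a ^+ #[a]./2).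
  by rewrite (cG (groupX _ Ga)) ?groupM ?groupV // mulgA.
by rewrite aE ballX.
Qed.

Lemma cycle3_inv u v : #[a] = 3 -> u \in <[a]> -> v \in <[a]> ->
  u != 1 -> v != 1 -> u != v -> v = u^-1.
Proof.
move=> a3 au av u1 v1 uv.
have pr3 : prime #[a] by rewrite a3.
have defu : <[u]> = <[a]>.
  apply/eqP; rewrite eqEcard cycle_subG au -!orderE a3.
  have u1' : #[u] != 1%N by rewrite order_eq1.
  by rewrite (prime_nt_dvdP pr3 u1' (order_dvdG au)) a3.
have u3 : #[u] = 3 by rewrite orderE defu -orderE.
move: av; rewrite -defu => /cyclePmin[i]; rewrite u3.
case: i => [|[|[|//]]] _ vE.
- by rewrite vE eqxx in v1.
- by rewrite vE expg1 eqxx in uv.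
by rewrite vE invg_expg u3.
Qed.

Lemma coset_factor c d : c \in G -> d \in G ->
  coset <[a]> d = coset <[a]> c -> exists2 u, u \in <[a]> & d = c * u.
Proof.
move=> Gc Gd e; exists (c^-1 * d); last by rewrite mulKVg.
exact: (coset_eq cGG sHG Gc Gd (esym e)).
Qed.

Lemma far_shift g k w u : g \in G -> far A (#[a]./2 + k) g -> w \in G ->
    coset <[a]> w = coset <[a]> g -> u \in <[a]> -> w * u \in ball A k ->
  far A #[a]./2 (u^-1 * (w^-1 * g)).
Proof.
move=> Gg fg Gw wE au wuk; rewrite mulgA -invMg.
have wuE : coset <[a]> (w * u) = coset <[a]> g.
  by rewrite coset_kerr.
by have [] := far_coset_eq Gg fg wuk wuE.
Qed.

(** If #[a] = 3, the lifts c, c * u and c * u^-1 would put three elements at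
    distance 1 in a group with two. *)
Lemma three_lifts x (r : seq (coset_of <[a]>)) c c1 c2 : perm_eq b (x :: r) ->
    #[a] = 3 -> #[x] = 3 -> c \in sym A -> c1 \in sym A -> c2 \in sym A ->
    coset <[a]> c = x -> coset <[a]> c1 = x -> coset <[a]> c2 = x ->
  [\/ c1 = c, c2 = c | c1 = c2].
Proof.
move=> bxr a3 x3 sc sc1 sc2 cx c1x c2x.
have Gc := sG sc; have [Gc1 Gc2] := (sG sc1, sG sc2).
have [g [Gg fg gE]] := localize1 bxr; rewrite x3 /= in fg gE.
have cg : coset <[a]> c = coset <[a]> g by rewrite cx gE.
pose u := c^-1 * c1; pose v := c^-1 * c2.
have au : u \in <[a]> by apply: (coset_eq cGG sHG); rewrite ?c1x.
have av : v \in <[a]> by apply: (coset_eq cGG sHG); rewrite ?c2x.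
have [c1c|nc1] := eqVneq c1 c; first by apply: Or31.
have [c2c|nc2] := eqVneq c2 c; first by apply: Or32.
have [e|ne] := eqVneq c1 c2; first by apply: Or33.
have u1 : u != 1 by rewrite -eq_mulVg1 eq_sym.
have v1 : v != 1 by rewrite -eq_mulVg1 eq_sym.
have uv : u != v by rewrite (inj_eq (mulgI _)).
have vE := cycle3_inv a3 au av u1 v1 uv.
have [az fz] := far_coset_eq Gg fg (sb1 sc) cg.
have fu := far_shift Gg fg Gc cg au; rewrite mulKVg in fu.
have fv := far_shift Gg fg Gc cg av; rewrite mulKVg in fv.
case/eqP: u1; apply: (far_half3 az au fz _ (fu (sb1 sc1))).
by rewrite -[u]invgK -vE; apply: fv (sb1 sc2).
Qed.

(** Both coordinates are nontrivial, as otherwise a single lift would be too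
    short a word; up to inversion they are (1, 1) or (1, -1). *)
Lemma localize2 x y (r : seq (coset_of <[a]>)) c d :
    perm_eq b [:: x, y & r] -> #[x] = 3 -> #[y] = 3 ->
    c \in sym A -> d \in sym A -> coset <[a]> c = x -> coset <[a]> d = y ->
  exists g, [/\ g \in G, far A (#[a]./2 + 2) g
    & coset <[a]> g = coset <[a]> (c * d) \/
      coset <[a]> g = coset <[a]> (c * d^-1)].
Proof.
move=> bxyr x3 y3 sc sd cx dy; have [Gc Gd] := (sG sc, sG sd).
have [g [L [Gg]]] := @localize [:: x; y] r bxyr.
rewrite !big_cons !big_nil dprodg1 x3 y3 /= => fg /dprodW <-.
case/mulsgP=> _ _ /cyclePmin[i lti ->] /cyclePmin[j ltj ->].
rewrite x3 in lti; rewrite y3 in ltj; rewrite -cx -dy => gE.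
have short w : w \in sym A -> coset <[a]> w = coset <[a]> g -> False.
  by move=> sw e; have [_ _] := far_coset Gg fg (sb1 sw) e.
have x2 : x ^+ 2 = x^-1 by rewrite invg_expg x3.
have y2 : y ^+ 2 = y^-1 by rewrite invg_expg y3.
rewrite -cx -dy in x2 y2.
have cdV : coset <[a]> (c * d)^-1 = (coset <[a]> c)^-1 * (coset <[a]> d)^-1.
  by rewrite (cG Gc Gd) invMg cosM ?groupV // !cosV.
have cdV' : coset <[a]> (c * d^-1)^-1 = (coset <[a]> c)^-1 * coset <[a]> d.
  by rewrite (cG Gc (groupVr Gd)) invMg invgK cosM ?groupV // cosV.
have sV w : w \in G -> coset <[a]> g = coset <[a]> w^-1 ->
    coset <[a]> g^-1 = coset <[a]> w.
  by move=> Gw e; rewrite cosV // e cosV // invgK.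
have fgV := farV fg; have GgV := groupVr Gg.
case: i lti gE => [|[|[|//]]] _; case: j ltj => [|[|[|//]]] _;
  rewrite ?x2 ?y2 ?expg0 ?expg1 ?mulg1 ?mul1g => gE.
- by case: (short 1 (sym1 A)); rewrite gE coset_id.
- by case: (short d sd).
- by case: (short d^-1); rewrite ?symV ?cosV.
- by case: (short c sc).
- by exists g; split=> //; left; rewrite cosM.
- by exists g; split=> //; right; rewrite cosM ?groupV // cosV.
- by case: (short c^-1); rewrite ?symV ?cosV.
- exists g^-1; split=> //; right; apply: sV; rewrite ?groupM ?groupV //.
  by rewrite cdV'.
exists g^-1; split=> //; left; apply: sV; rewrite ?groupM //.
by rewrite cdV.
Qed.

(** The far element is over x * y^-1, since e itself is a single letter over
    x * y. If e = c * d * u, then the three words c * d^-1, e * d and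
    e^-1 * c^-1 of length 2 over x * y^-1 are c * d^-1 multiplied by 1, u and
    u^-1 respectively. *)
Lemma pair_lift x y (r : seq (coset_of <[a]>)) c d e :
    perm_eq b [:: x, y & r] -> #[x] = 3 -> #[y] = 3 ->
    c \in sym A -> d \in sym A -> e \in sym A ->
    coset <[a]> c = x -> coset <[a]> d = y -> coset <[a]> e = x * y ->
  e = c * d.
Proof.
move=> bxyr x3 y3 sc sd se cx dy exy.
have [[Gc Gd] Ge] := (sG sc, sG sd, sG se).
have c3 : c ^+ 3 = 1.
  by rewrite -x3 -(order_lift bxyr _ sc cx) ?expg_order // x3.
have d3 : d ^+ 3 = 1.
  rewrite -y3 -(@order_lift y (x :: r) d _ _ sd dy) ?expg_order // ?y3 //.
  by rewrite (permPl bxyr); apply: permEl (perm_catCA [:: x] [:: y] r).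
have [g [Gg fg gE]] := localize2 bxyr x3 y3 sc sd cx dy.
have eE : coset <[a]> e = coset <[a]> (c * d) by rewrite cosM // cx dy.
case: gE => gE.
  have eg : coset <[a]> e = coset <[a]> g by rewrite gE.
  by have [_ _] := far_coset Gg fg (sb1 se) eg.
have [u au eu] := coset_factor (groupM Gc Gd) Ge eE.
have Gu := aG au.
have Gw : c * d^-1 \in G by rewrite groupM ?groupV.
have wb : c * d^-1 \in ball A 2.
  by apply: (@ballM _ A 1 1); rewrite ball1 ?symV.
have [az fz] := far_coset_eq Gg fg wb (esym gE).
have d2 : d * d = d^-1.
  by apply/eqP; rewrite eq_sym eq_invg_mul -[d * (d * d)]/(d ^+ 3) d3.
have c2 : c * c = c^-1.
  by apply/eqP; rewrite eq_sym eq_invg_mul -[c * (c * c)]/(c ^+ 3) c3.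
have wu : c * d^-1 * u \in ball A 2.
  have -> : c * d^-1 * u = e * d by rewrite eu -d2 -!mulgA (cG Gu Gd).
  by apply: (@ballM _ A 1 1); rewrite ball1.
have wuV : c * d^-1 * u^-1 \in ball A 2.
  have -> : c * d^-1 * u^-1 = e^-1 * c^-1.
    apply: invg_inj; rewrite !invMg !invgK eu.
    rewrite [RHS]mulgA [c * (c * d)]mulgA c2 (cG Gd (groupVr Gc)).
    by rewrite (cG Gu) // groupM ?groupV.
  by apply: (@ballM _ A 1 1); rewrite ball1 symV.
have fu := far_shift Gg fg Gw (esym gE) au wu.
have fuV := far_shift Gg fg Gw (esym gE) (groupVr au) wuV.
rewrite invgK in fuV.
by rewrite eu (far_half3 az au fz fuV fu) mulg1.
Qed.

(** Two independent choices of lifts give the differences 1, u, v and u * v,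
    which exhaust a group of order 3, so one of the words of length 2 would be
    the far element itself. *)
Lemma two_double_lifts x y (r : seq (coset_of <[a]>)) c c1 d d1 :
    perm_eq b [:: x, y & r] -> #[a] = 3 -> #[x] = 3 -> #[y] = 3 ->
    c \in sym A -> c1 \in sym A -> d \in sym A -> d1 \in sym A ->
    coset <[a]> c = x -> coset <[a]> c1 = x ->
    coset <[a]> d = y -> coset <[a]> d1 = y ->
  c1 = c \/ d1 = d.
Proof.
move=> bxyr a3 x3 y3 sc sc1 sd sd1 cx c1x dy d1y.
have [[Gc Gd] [Gc1 Gd1]] := ((sG sc, sG sd), (sG sc1, sG sd1)).
have [c1c|nc1] := eqVneq c1 c; [by left | right].
apply/eqP; apply: contraTT isT => nd1.
have [g [Gg fg gE]] := localize2 bxyr x3 y3 sc sd cx dy.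
have key D D1 : D \in sym A -> D1 \in sym A -> D1 != D ->
    coset <[a]> D1 = coset <[a]> D ->
    coset <[a]> (c * D) = coset <[a]> g -> False.
  move=> sD sD1 nD DD cDg; have [GD GD1] := (sG sD, sG sD1).
  have [u au c1E] := coset_factor Gc Gc1 (etrans c1x (esym cx)).
  have [v av D1E] := coset_factor GD GD1 DD.
  have u1 : u != 1 by apply: contraNneq nc1 => u1; rewrite c1E u1 mulg1.
  have v1 : v != 1 by apply: contraNneq nD => v1; rewrite D1E v1 mulg1.
  have [Gu Gv] := (aG au, aG av).
  have B2 s t : s \in sym A -> t \in sym A -> s * t \in ball A 2.
    by move=> ss st; apply: (@ballM _ A 1 1); rewrite ball1.
  have cDu : c * D * u = c1 * D by rewrite c1E -!mulgA (cG GD Gu).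
  have cDv : c * D * v = c * D1 by rewrite D1E mulgA.
  have cDuv : c * D * (u * v) = c1 * D1 by rewrite mulgA cDu D1E mulgA.
  have GcD := groupM Gc GD.
  have [az fz] := far_coset_eq Gg fg (B2 _ _ sc sD) cDg.
  have fu := far_shift Gg fg GcD cDg au; rewrite cDu in fu.
  have fv := far_shift Gg fg GcD cDg av; rewrite cDv in fv.
  have fuv := far_shift Gg fg GcD cDg (groupM au av); rewrite cDuv in fuv.
  have {}fu := fu (B2 _ _ sc1 sD); have {}fv := fv (B2 _ _ sc sD1).
  have {}fuv := fuv (B2 _ _ sc1 sD1).
  suff ux : u = 1 by rewrite ux eqxx in u1.
  have [e|ne] := eqVneq u v.
    apply: (far_half3 (groupM (groupVr au) az) au fu); first by rewrite mulKVg.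
    by move: fuv; rewrite -e invMg -mulgA.
  have vE := cycle3_inv a3 au av u1 v1 ne.
  by apply: (far_half3 az au fz _ fu); rewrite -[u]invgK -vE.
have [e|e] := gE; first by case: (key d d1) => //; rewrite dy.
case: (key d^-1 d1^-1); rewrite ?symV ?(inj_eq invg_inj) //.
by rewrite !cosV // dy d1y.
Qed.

End Localization.

(** * Extremal generating sets contain an element of maximal order *)

Lemma abelian_type_total (gT : finGroupType) (G : {group gT}) :
  {in abelian_type G &, forall u v, (u %| v) || (v %| u)}.
Proof.
have dvdT : transitive [rel m n | n %| m].
  by move=> y x z /= xy yz; apply: dvdn_trans yz xy.
have := abelian_type_dvdn_sorted G; elim: (abelian_type G) => // t s IH.
rewrite /= path_sortedE // => /andP[/allP ts /IH{}IH] u v; rewrite !inE.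
case/predU1P=> [->|us] /predU1P[->|vs]; rewrite ?dvdnn //.
- by apply/orP; right; apply: (ts _ vs).
- by apply/orP; left; apply: (ts _ us).
exact: IH.
Qed.

(** The existence of a far element turns the upper bound into an equality at
    its first step, whichever generator is peeled off. *)
Lemma far_weight_cycle (gT : finGroupType) (G : {group gT}) (A : {set gT})
    (g a : gT) :
    abelian G -> <<A>> = G -> g \in G -> far A (weight G) g -> a \in sym A ->
  weight G = (#[a]./2 + weight (G / <[a]>))%N.
Proof.
move=> cGG genA Gg fg sa; have sAG : A \subset G by rewrite -genA subset_gen.
have Ga : a \in G by apply: subsetP sa; rewrite sym_subG.
have sHG : <[a]> \subset G by rewrite cycle_subG.
have [le _] := weight_quotient cGG Ga.
apply/eqP; rewrite eqn_leq le andbT; apply: fg.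
suff /subsetP : G \subset ball A (#[a]./2 + weight (G / <[a]>)) by apply.
apply: (ball_extension cGG sAG sHG).
  by apply/subsetP=> x; apply: cycle_ball.
apply: sub_ball_weight; rewrite ?quotient_abelian //=.
rewrite -quotient_gen ?genA //.
exact: subset_trans sAG (sub_abelian_norm cGG sHG).
Qed.

(** All orders of generators are invariant factors, or 2 in the presence of 4.
    They form a chain for divisibility, so the largest is a common multiple and
    hence the exponent. *)
Lemma extremal_exponent (gT : finGroupType) (G : {group gT}) (A : {set gT})
    (g : gT) :
    abelian G -> <<A>> = G -> g \in G -> far A (weight G) g ->
  exists2 a, a \in sym A & #[a] = exponent G.
Proof.
move=> cGG genA Gg fg; have sAG : A \subset G by rewrite -genA subset_gen.
have typ a : a \in sym A -> a != 1 ->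
    #[a] \in abelian_type G \/ #[a] = 2%N /\ 4 \in abelian_type G.
  move=> sa a1; have Ga : a \in G by apply: subsetP sa; rewrite sym_subG.
  have [_] := weight_quotient cGG Ga.
  by apply=> //; apply: (far_weight_cycle cGG genA Gg fg sa).
have tot2 v : v \in abelian_type G -> 4 \in abelian_type G -> 2 %| v.
  move=> vt t4; have v1 : (1 < v)%N by apply: (allP (abelian_type_gt1 G)).
  have /orP[|] := abelian_type_total vt t4; last exact: dvdn_trans.
  rewrite (dvdn_divisors v (isT : (0 < 4)%N)) !inE => /or3P[] /eqP vE.
  - by rewrite vE in v1.
  - by rewrite vE.
  by rewrite vE.
have tot a s : a \in sym A -> s \in sym A -> (#[a] %| #[s]) || (#[s] %| #[a]).
  move=> sa ss.
  have [->|/(typ a sa) ta] := eqVneq a 1; first by rewrite order1 dvd1n.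
  have [->|/(typ s ss) ts] := eqVneq s 1; first by rewrite order1 dvd1n orbT.
  case: ta ts => [ta|[a2 t4]] [ts|[s2 t4']].
  - exact: (abelian_type_total ta ts).
  - by rewrite s2 tot2 ?orbT.
  - by rewrite a2 tot2.
  by rewrite a2 s2.
have [a sa amax] := arg_maxnP (fun x : gT => #[x]) (sym1 A).
exists a => //; apply/eqP; rewrite eqn_dvd dvdn_exponent //=; last first.
  by apply: subsetP sa; rewrite sym_subG.
have cAA : abelian A := abelianS sAG cGG.
rewrite -genA abelian_exponent_gen //; apply/exponentP=> s As.
apply/eqP; rewrite -order_dvdn.
have ss := subsetP (sub_sym A) _ As.
have /orP[ad|//] := tot a s sa ss.
have := amax s ss => /= le; suff -> : #[s] = #[a] by [].
by apply/eqP; rewrite eqn_leq le dvdn_leq.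
Qed.

(** If lifts keep their orders, the map from each cyclic factor of the quotient
    is a section, and the direct decomposition lifts. *)
Lemma lift_dprod (gT : finGroupType) (G : {group gT}) (a : gT)
    (b : seq (coset_of <[a]>)) (f : coset_of <[a]> -> gT) :
    abelian G -> a \in G -> \big[dprod/1]_(x <- b) <[x]> = G / <[a]> ->
    (forall x, x \in b ->
      [/\ f x \in G, coset <[a]> (f x) = x & #[f x] = #[x]]) ->
  \big[dprod/1]_(x <- a :: map f b) <[x]> = G.
Proof.
move=> cGG Ga defb fP; have sHG : <[a]> \subset G by rewrite cycle_subG.
have nHG := sub_abelian_norm cGG sHG.
have main (K : {group coset_of <[a]>}) : \big[dprod/1]_(x <- b) <[x]> = K ->
    exists L : {group gT}, [/\ \big[dprod/1]_(x <- map f b) <[x]> = L,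
      L \subset G, L / <[a]> = K & <[a]> :&: L = 1].
  elim: b {defb} fP K => [|x b IH] fP K.
    rewrite !big_nil => <-; exists 1%G; rewrite quotient1 sub1G setIg1.
    by split.
  rewrite !big_cons; case/dprodP=> [[_ K' _ defK'] defK _ tiK].
  have fP' y : y \in b -> [/\ f y \in G, coset <[a]> (f y) = y & #[f y] = #[y]].
    by move=> yb; apply: fP; rewrite inE yb orbT.
  have [L [defL sLG LK' tiL]] := IH fP' _ defK'.
  have [Gfx fxE ofx] := fP x (mem_head _ _).
  have sfx : <[f x]> \subset G by rewrite cycle_subG.
  have nG y : y \in G -> y \in 'N(<[a]>) by apply: subsetP.
  have fxq : <[f x]> / <[a]> = <[x]> by rewrite quotient_cycle ?nG // fxE.
  rewrite defK' in tiK defK.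
  have ti : <[f x]> :&: L = 1.
    apply/trivgP/subsetP=> z /setIP[xz Lz].
    have : coset <[a]> z \in <[x]> :&: K'.
      by rewrite inE -fxq -LK' !mem_quotient.
    rewrite tiK => /set1P/coset_idr az.
    rewrite -tiL inE Lz andbT; apply: az; apply: nG; exact: (subsetP sLG).
  have jE : <[f x]> <*> L = <[f x]> * L.
    exact: norm_joinEl (subset_trans sfx (sub_abelian_norm cGG sLG)).
  exists (<[f x]> <*> L)%G; rewrite /= defL; split.
  - by rewrite dprodEY // (sub_abelian_cent2 cGG).
  - by rewrite join_subG sfx.
  - by rewrite jE quotientMl ?(subset_trans sfx) // fxq LK'.
  apply/trivgP/subsetP=> z /setIP[az].
  rewrite /= jE; case/mulsgP=> y l xy Ll zE.
  have [Gy Gl] := (subsetP sfx _ xy, subsetP sLG _ Ll).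
  have cyl : coset <[a]> y * coset <[a]> l = 1.
    by rewrite -morphM ?nG // -zE /= coset_id.
  have cy1 : coset <[a]> y = 1.
    suff : coset <[a]> y \in <[x]> :&: K' by rewrite tiK => /set1P.
    rewrite inE -fxq mem_quotient //=.
    rewrite -[coset _ y](mulgK (coset <[a]> l)) cyl mul1g groupV -LK'.
    exact: mem_quotient.
  have y1 : y = 1.
    have /cycleP[i yE] := xy; apply/eqP; rewrite yE -order_dvdn ofx order_dvdn.
    by rewrite -{1}fxE -morphX ?nG //= -yE cy1.
  have : z \in <[a]> :&: L by rewrite inE az zE y1 mul1g.
  by rewrite tiL.
have [L [defL sLG LG tiL]] := main _ defb.
rewrite big_cons defL dprodE // ?(sub_abelian_cent2 cGG) //.
by apply/eqP; rewrite eqEsubset mul_subG //= -quotientSK // LG.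
Qed.

(** * Extremal generating sets are unions of blocks *)

Definition flat (T : Type) (P : seq (T * T)) : seq T :=
  flatten [seq [:: p.1; p.2] | p <- P].

(** The pairs in P span the blocks {x, y, x * y} and the entries of U are the
    singleton blocks. Keeping only the pairs whose product is really present
    makes the description of an extremal set exact, and spares any
    bookkeeping of positions in the induction. *)
Definition block_gens (gT : finGroupType) (P : seq (gT * gT)) (U : seq gT) :
    {set gT} :=
  [set x in flat P ++ U] :|: [set x in [seq p.1 * p.2 | p <- P]].

(** Bases are compared with the type up to permutation; the order of the
    entries is chosen only at the end. *)
Definition block_basis (gT : finGroupType) (G : {group gT})
    (P : seq (gT * gT)) (U : seq gT) : Prop :=
  [/\ \big[dprod/1]_(x <- flat P ++ U) <[x]> = G,
      perm_eq (map order (flat P ++ U)) (abelian_type G)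
    & forall x, x \in flat P -> #[x] = 3].

Lemma flat_map (T T' : Type) (f : T -> T') (P : seq (T * T)) :
  flat [seq (f p.1, f p.2) | p <- P] = map f (flat P).
Proof. by elim: P => //= p P; rewrite /flat /= => ->. Qed.

Lemma perm_flat (T : eqType) (P Q : seq (T * T)) :
  perm_eq P Q -> perm_eq (flat P) (flat Q).
Proof. by move=> PQ; apply/perm_flatten/perm_map. Qed.

Lemma mem_block_gens (gT : finGroupType) (P : seq (gT * gT)) (U : seq gT) x :
  (x \in block_gens P U) =
    (x \in flat P ++ U) || (x \in [seq p.1 * p.2 | p <- P]).
Proof. by rewrite !inE. Qed.

Lemma sym_sub (gT : finGroupType) (A B : {set gT}) :
  B \subset sym A -> sym B \subset sym A.
Proof.
move=> /subsetP sBA; apply/subsetP=> x; rewrite mem_sym.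
by case/or3P=> [/eqP->|/sBA //|/sBA]; rewrite ?sym1 ?symV.
Qed.

Lemma bigdprod_sub (gT : finGroupType) (b : seq gT) (G : {group gT}) x :
  \big[dprod/1]_(y <- b) <[y]> = G -> x \in b -> x \in G.
Proof.
move=> defG xb; rewrite -cycle_subG -(bigdprodWY defG).
by rewrite (big_rem x) //= joing_subl.
Qed.

Lemma weight_basis (gT : finGroupType) (G : {group gT}) (b : seq gT) :
    perm_eq (map order b) (abelian_type G) ->
  weight G = \sum_(x <- b) #[x]./2.
Proof. by move=> bt; rewrite /weight -(perm_big _ bt) big_map. Qed.

(** Choose lifts f x of the basis elements. If all lifts are unique, the blocks
    lift one by one, and a is a new singleton block. Otherwise #[a] = 3 and
    exactly one basis element x0 has two lifts, f x0 and f x0 * a for a suitable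
    choice of f. It belongs to no pair, because the product of that pair would
    determine the lift, so that (f x0, a) can be added as a new pair. *)
Lemma extremal_step (gT : finGroupType) (G : {group gT}) (A : {set gT})
    (g a : gT) (P : seq (coset_of <[a]> * coset_of <[a]>)) U :
    abelian G -> A \subset G -> G :!=: 1 ->
    g \in G -> far A (weight G) g -> a \in sym A -> #[a] = exponent G ->
    block_basis (G / <[a]>) P U -> sym (A / <[a]>) = sym (block_gens P U) ->
  exists P1, exists U1, block_basis G P1 U1 /\ sym A = sym (block_gens P1 U1).
Proof.
move=> cGG sAG ntG Gg fg sa oa [defb permb ord3] symE.
have Ga : a \in G by apply: subsetP sa; rewrite sym_subG.
have sG x : x \in sym A -> x \in G by apply/subsetP; rewrite sym_subG.
have sHG : <[a]> \subset G by rewrite cycle_subG.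
have nG x : x \in G -> x \in 'N(<[a]>).
  exact: (subsetP (sub_abelian_norm cGG sHG)).
set b := flat P ++ U in defb permb.
have sb : {subset b <= sym (A / <[a]>)}.
  move=> x xb; rewrite symE; apply: (subsetP (sub_sym _)).
  by rewrite mem_block_gens xb.
have fg0 : far A (#[a]./2 + \sum_(x <- b) #[x]./2) g.
  by rewrite -(weight_basis permb) -weight_cons.
have b_gt1 x : x \in b -> (1 < #[x])%N.
  move=> xb; have := allP (abelian_type_gt1 (G / <[a]>)) #[x]; apply.
  by rewrite -(perm_mem permb); apply: map_f.
have lift x : x \in sym (A / <[a]>) -> exists2 c, c \in sym A & coset <[a]> c = x.
  by rewrite -!ball1 => /(ball_lift cGG sAG sHG).
pose f0 x := odflt 1 [pick c in sym A | coset <[a]> c == x].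
pose lifting f := forall x, x \in b -> f x \in sym A /\ coset <[a]> (f x) = x.
have f0P : lifting f0.
  move=> x /sb/lift[c sc cx]; rewrite /f0.
  case: pickP => [d /andP[sd /eqP]|/(_ c)] //=.
  by rewrite sc cx eqxx.
have permx x : x \in b -> perm_eq b (x :: rem x b) by apply: perm_to_rem.
have perm2 x y : x \in b -> y \in b -> x != y ->
    perm_eq b [:: x, y & rem y (rem x b)].
  move=> xb yb xy; rewrite (permPl (permx x xb)) perm_cons perm_to_rem //.
  by move: yb; rewrite (perm_mem (permx x xb)) inE eq_sym (negPf xy).
have permP p : p \in P -> perm_eq b [:: p.1, p.2 & flat (rem p P) ++ U].
  move=> pP; rewrite -[_ :: _]/(flat (p :: rem p P) ++ U) perm_cat2r.
  exact/perm_flat/perm_to_rem.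
have Pb p : p \in P -> [/\ p.1 \in b, p.2 \in b, #[p.1] = 3 & #[p.2] = 3].
  move=> pP; have eqb := perm_mem (permP p pP).
  have eqP := perm_mem (perm_flat (perm_to_rem pP)).
  rewrite !eqb !inE !eqxx orbT; split=> //; apply: ord3;
  by rewrite eqP !inE eqxx ?orbT.
have pairP f p e : lifting f -> p \in P -> e \in sym A ->
    coset <[a]> e = p.1 * p.2 -> e = f p.1 * f p.2.
  move=> fP pP se eE; have [p1b p2b o1 o2] := Pb p pP.
  have [[sf1 f1E] [sf2 f2E]] := (fP _ p1b, fP _ p2b).
  exact: (pair_lift cGG sAG sa defb sb Gg fg0 oa (permP p pP) o1 o2
    sf1 sf2 se f1E f2E).
have prodP p : p \in P -> exists2 e, e \in sym A & coset <[a]> e = p.1 * p.2.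
  move=> pP; apply: lift; rewrite symE; apply: (subsetP (sub_sym _)).
  by rewrite mem_block_gens orbC (map_f (fun q => q.1 * q.2)) .
have ordf f x : lifting f -> x \in b -> #[f x] = #[x].
  move=> fP xb; have [sf fE] := fP x xb.
  exact: (order_lift cGG sAG sa defb sb Gg fg0 oa (permx x xb)
    (b_gt1 x xb) sf fE).
have b3 x : x \in flat P -> x \in b /\ #[x] = 3.
  by move=> xP; rewrite mem_cat xP; split=> //; apply: ord3.
have basis f P1 U1 : lifting f -> perm_eq (flat P1 ++ U1) (a :: map f b) ->
    (forall x, x \in flat P1 -> #[x] = 3) -> block_basis G P1 U1.
  move=> fP perm1 o3; split=> //.
    rewrite (perm_big _ perm1); apply: lift_dprod => // x xb.
    by have [sf fE] := fP x xb; split; rewrite ?sG ?ordf.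
  rewrite (permPl (perm_map _ perm1)) (abelian_type_cons cGG ntG Ga oa) /=.
  rewrite perm_cons.
  rewrite -(permPr permb) -map_comp.
  rewrite (_ : map _ b = map order b) //.
  by apply/eq_in_map => x xb /=; apply: ordf.
have symsub (f : coset_of <[a]> -> gT) P1 U1 : lifting f ->
    (forall x, (x \in flat P1 ++ U1) = (x \in a :: map f b)) ->
    (forall p, p \in P -> f p.1 * f p.2 \in [seq q.1 * q.2 | q <- P1]) ->
    (forall s, s \in sym A -> coset <[a]> s \in b -> s \in block_gens P1 U1) ->
    sym A \subset sym (block_gens P1 U1).
  move=> fP mem1 prod1 bs.
  have key s : s \in sym A ->
      coset <[a]> s = 1 \/ coset <[a]> s \in block_gens P U ->
      s \in sym (block_gens P1 U1).
    move=> ss.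
    have gen1 x : x \in block_gens P1 U1 -> x \in sym (block_gens P1 U1).
      exact: (subsetP (sub_sym _)).
    have ga : a \in sym (block_gens P1 U1).
      by apply: gen1; rewrite mem_block_gens mem1 mem_head.
    case=> [s1|].
      have as_ : s \in <[a]> by apply: coset_idr s1; apply/nG/sG.
      have [->|->|->] := sym_cycle cGG sAG sa defb sb Gg fg0 ss as_.
      + exact: sym1.
      + exact: ga.
      by rewrite symV.
    rewrite mem_block_gens => /orP[/(bs _ ss)/gen1 //|/mapP[p pP sE]].
    rewrite (pairP f p s fP pP ss sE); apply: gen1.
    by rewrite mem_block_gens orbC prod1.
  apply/subsetP=> s ss; have Gs := sG _ ss.
  have : coset <[a]> s \in sym (A / <[a]>).
    by rewrite -ball1 (coset_ball cGG sAG sHG) // ball1.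
  rewrite symE mem_sym => /or3P[/eqP s1|s1|s1].
  - by apply: (key s ss); left.
  - by apply: (key s ss); right.
  by rewrite -symV; apply: key; rewrite ?symV // morphV ?nG //; right.
have sprods f p : lifting f -> p \in P -> f p.1 * f p.2 \in sym A.
  by move=> fP pP; have [e se eE] := prodP p pP; rewrite -(pairP f p e).
pose uniql := [forall x in [set x in b],
  [forall s in sym A, (coset <[a]> s == x) ==> (s == f0 x)]].
have [uniq|nuniq] := boolP uniql.
  pose P1 := [seq (f0 p.1, f0 p.2) | p <- P]; pose U1 := a :: map f0 U.
  have perm1 : perm_eq (flat P1 ++ U1) (a :: map f0 b).
    rewrite flat_map /b map_cat.
    exact: permEl (perm_catCA _ [:: a] _).
  exists P1, U1; split.
    apply: (basis f0 _ _ f0P perm1) => x; rewrite flat_map => /mapP[y yP ->].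
    by have [yb y3] := b3 y yP; rewrite (ordf f0 y f0P yb).
  apply/eqP; rewrite eqEsubset; apply/andP; split.
    apply: (symsub f0 _ _ f0P (perm_mem perm1)).
      move=> p pP; apply/mapP; exists (f0 p.1, f0 p.2) => //.
      by apply/mapP; exists p.
    move=> s ss sE; rewrite mem_block_gens (perm_mem perm1) inE.
    move/forall_inP: uniq => /(_ (coset <[a]> s)); rewrite inE => /(_ sE).
    move/forall_inP=> /(_ s ss)/implyP/(_ (eqxx _))/eqP ->.
    by rewrite map_f ?orbT.
  apply: sym_sub; apply/subsetP=> s; rewrite mem_block_gens (perm_mem perm1) inE.
  case/orP=> [/predU1P[->//|/mapP[x xb ->]]|/mapP[_ /mapP[p pP ->] ->]].
    by have [] := f0P x xb.
  exact: sprods.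
have [x0 x0b [f [fP sfa a3]]] : exists2 x0, x0 \in b & exists f,
    [/\ lifting f, f x0 * a \in sym A & #[a] = 3].
  have /forall_inPn[x0] := nuniq; rewrite inE => x0b /forall_inPn[s ss].
  rewrite negb_imply => /andP[/eqP sE nsf].
  have [sf fE] := f0P x0 x0b; exists x0 => //.
  have a3 := two_lifts cGG sAG sa defb sb Gg fg0 oa (permx x0 x0b) (b_gt1 x0 x0b)
    sf ss fE sE nsf.
  have := coset_eq cGG sHG (sG _ sf) (sG _ ss) (etrans fE (esym sE)).
  case/cyclePmin=> i; rewrite a3 => lti uE.
  have {uE} sfE : s = f0 x0 * a ^+ i by rewrite -uE mulKVg.
  case: i lti sfE => [|[|[|//]]] _ sfE.
  - by rewrite sfE mulg1 eqxx in nsf.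
  - by exists f0; rewrite -sfE.
  (* Here s = f0 x0 * a^-1, and s has to replace f0 x0 as the chosen lift. *)
  exists (fun x => if x == x0 then s else f0 x); rewrite eqxx; split=> //.
    by move=> x xb; case: eqP => [->|_]; [|apply: f0P].
  by rewrite sfE -mulgA -expgSr -a3 expg_order mulg1.
have [sf fE] := fP x0 x0b; have Gf := sG _ sf.
have faE : coset <[a]> (f x0 * a) = x0 by rewrite coset_kerr ?cycle_id.
have nfa : f x0 * a != f x0.
  by rewrite eq_mulVg1 invMg mulgKV eq_invg1 -order_eq1 a3.
have x3 x : x \in b -> #[x] = 3.
  move=> xb; have x1 : #[x] != 1%N by rewrite neq_ltn b_gt1 ?orbT.
  have : #[x] %| 3.
    rewrite -a3 oa; apply: dvdn_trans (exponent_quotient G <[a]>).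
    by rewrite dvdn_exponent // (bigdprod_sub defb).
  by move/(prime_nt_dvdP (isT : prime 3) x1).
have nx0P : x0 \notin flat P.
  (* If x0 were in a pair, both lifts of x0 would give the same product. *)
  pose f' x := if x == x0 then f x0 * a else f x.
  have f'P : lifting f'.
    by move=> x xb; rewrite /f'; case: eqP => [->|_]; [|apply: fP].
  apply/negP=> /flatten_mapP[p pP x0p].
  have [e se eE] := prodP p pP.
  have := pairP f p e fP pP se eE; rewrite (pairP f' p e f'P pP se eE) /f'.
  have a1 : a != 1 by rewrite -order_eq1 a3.
  move: x0p; rewrite !inE eq_sym [x0 == _]eq_sym.
  case: eqP => [->|_]; case: eqP => [->|_] //= _.
  - move=> e2; have /eqP : a ^+ 2 = 1; last by rewrite -order_dvdn a3.
    apply: (mulgI (f x0 * f x0)); rewrite mulg1 -[RHS]e2 -!mulgA; congr (_ * _).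
    by rewrite !mulgA (centsP cGG _ Gf _ Ga).
  - by rewrite -mulgA => /mulgI/eqP; rewrite eq_mulgV1 mulgK (negPf a1).
  by rewrite mulgA -[RHS]mulg1 => /mulgI/eqP; rewrite (negPf a1).
have x0U : x0 \in U by move: x0b; rewrite mem_cat (negPf nx0P).
pose P1 := (f x0, a) :: [seq (f p.1, f p.2) | p <- P].
pose U1 := map f (rem x0 U).
have perm1 : perm_eq (flat P1 ++ U1) (a :: map f b).
  rewrite -[flat P1]/([:: f x0; a] ++ flat [seq (f p.1, f p.2) | p <- P]).
  rewrite flat_map -catA -map_cat.
  apply: perm_trans (permEl (perm_catCA [:: f x0] [:: a] _)) _.
  rewrite perm_cons -[[:: f x0] ++ _]/(map f (x0 :: (flat P ++ rem x0 U))).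
  apply: perm_map; rewrite -cat1s -(permPl (permEl (perm_catCA _ _ _))).
  by rewrite perm_cat2l perm_sym perm_to_rem.
exists P1, U1; split.
  apply: (basis f _ _ fP perm1) => x.
  rewrite -[flat P1]/([:: f x0; a] ++ flat [seq (f p.1, f p.2) | p <- P]).
  rewrite flat_map mem_cat !inE -orbA => /or3P[/eqP->|/eqP->//|/mapP[y yP ->]].
    by rewrite (ordf f x0 fP x0b) x3.
  by have [yb y3] := b3 y yP; rewrite (ordf f y fP yb).
apply/eqP; rewrite eqEsubset; apply/andP; split.
  apply: (symsub f _ _ fP (perm_mem perm1)).
    move=> p pP; apply/mapP; exists (f p.1, f p.2) => //.
    by rewrite inE; apply/orP; right; apply/mapP; exists p.
  move=> s ss sE; rewrite mem_block_gens.
  have [sx0|sx0] := eqVneq (coset <[a]> s) x0.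
    have [e|e|e] := three_lifts cGG sAG sa defb sb Gg fg0 (permx x0 x0b) a3
      (x3 x0 x0b) sf sfa ss fE faE sx0.
    - by rewrite e eqxx in nfa.
    - by rewrite e (perm_mem perm1) inE map_f ?orbT.
    by apply/orP; right; rewrite -e inE eqxx.
  have [sfs fsE] := fP _ sE; rewrite eq_sym in sx0.
  have [e|->] := two_double_lifts cGG sAG sa defb sb Gg fg0
    (perm2 _ _ x0b sE sx0) a3 (x3 _ x0b) (x3 _ sE) sf sfa sfs ss fE faE fsE erefl.
    by rewrite e eqxx in nfa.
  by rewrite (perm_mem perm1) inE map_f ?orbT.
apply: sym_sub; apply/subsetP=> s; rewrite mem_block_gens (perm_mem perm1) inE.
case/orP=> [/predU1P[->//|/mapP[x xb ->]]|/=].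
  by have [] := fP x xb.
rewrite inE => /predU1P[->//|/mapP[_ /mapP[p pP ->] ->]].
exact: sprods.
Qed.

Lemma trivg_abelian_type (gT : finGroupType) (G : {group gT}) :
  G :=: 1 -> abelian_type G = [::].
Proof.
move=> G1; rewrite (@abelian_typeE _ G [::]) ?big_nil //.
by rewrite G1 abelian1.
Qed.

Theorem extremal_blocks (gT : finGroupType) (G : {group gT}) (A : {set gT})
    (g : gT) :
    abelian G -> <<A>> = G -> g \in G -> far A (weight G) g ->
  exists P, exists U, block_basis G P U /\ sym A = sym (block_gens P U).
Proof.
have [n] := ubnP #|G|; elim: n gT G A g => // n IH gT G A g leGn cGG genA Gg fg.
have sAG : A \subset G by rewrite -genA subset_gen.
have [G1|ntG] := eqVneq (G : {set gT}) 1.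
  exists [::], [::]; split.
    by split=> //=; rewrite ?big_nil ?(trivg_abelian_type G1).
  apply/eqP; rewrite eqEsubset; apply/andP; split; apply: sym_sub.
    by apply/subsetP=> x /(subsetP sAG); rewrite G1 => /set1P->; apply: sym1.
  by apply/subsetP=> x; rewrite mem_block_gens.
have [a sa oa] := extremal_exponent cGG genA Gg fg.
have Ga : a \in G by apply: subsetP sa; rewrite sym_subG.
have sHG : <[a]> \subset G by rewrite cycle_subG.
have a1 : a != 1.
  rewrite -order_eq1 oa; apply: contra ntG => /eqP e1.
  by rewrite trivg_exponent e1.
have ltG : (#|G / <[a]>| < n)%N.
  rewrite ltnS in leGn; apply: leq_trans leGn.
  by rewrite ltn_quotient // cycle_eq1.
have genA' : <<(A / <[a]>)>> = G / <[a]>.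
  rewrite -quotient_gen ?genA //.
  exact: subset_trans sAG (sub_abelian_norm cGG sHG).
have fg' : far (A / <[a]>) (weight (G / <[a]>)) (coset <[a]> g).
  move=> k /(ball_lift cGG sAG sHG)[w wk wE].
  have Gw : w \in G := subsetP (ball_sub k sAG) _ wk.
  rewrite -(leq_add2l #[a]./2) -weight_cons //; apply: fg.
  rewrite -(mulKVg w g) addnC ballM // cycle_ball //.
  exact: (coset_eq cGG sHG).
have [P [U [PU symE]]] :=
  IH _ _ _ _ ltG (quotient_abelian _ cGG) genA' (mem_quotient _ Gg) fg'.
exact: (extremal_step cGG sAG ntG Gg fg sa oa PU symE).
Qed.

(** * Unions of blocks are extremal *)

Section FarElements.
Variable gT : finGroupType.
Implicit Types (A B : {set gT}) (x y g : gT) (G H K : {group gT}).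

Lemma ball_setU A B H K k g :
    A \subset H -> B \subset K -> K \subset 'C(H) -> g \in ball (A :|: B) k ->
  exists i, exists j, exists u, exists v,
    [/\ (i + j = k)%N, u \in ball A i, v \in ball B j & g = u * v].
Proof.
move=> sAH sBK cHK; elim: k g => [|k IH] g.
  rewrite ball0 => /eqP->; exists 0, 0, 1, 1.
  by rewrite !ball_one mulg1.
rewrite /ball expgS => /mulsgP[s g' ss /IH[i [j [u [v [<- ui vj ->]]]]] ->].
have [sA|sB] : s \in sym A \/ s \in sym B.
  move: ss; rewrite !mem_sym !inE.
  by case: (s == 1) (s \in A) (s \in B) (s^-1 \in A) => [] [] [] [] //=; auto.
  exists i.+1, j, (s * u), v; split; rewrite ?mulgA //.
  by apply: (@ballM _ A 1 i); rewrite ?ball1.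
have Hu := subsetP (ball_sub i sAH) _ ui.
have Ks : s \in K by apply: subsetP sB; rewrite sym_subG.
exists i, j.+1, u, (s * v); split; rewrite ?addnS //.
  by apply: (@ballM _ B 1 j); rewrite ?ball1.
by rewrite !mulgA; congr (_ * _); apply: (centsP cHK).
Qed.

(** A word splits into its letters in A and its letters in B, which have to
    produce x and y separately. *)
Lemma far_dprod A B G H K m n x y :
    H \x K = G -> A \subset H -> B \subset K -> x \in H -> y \in K ->
    far A m x -> far B n y ->
  far (A :|: B) (m + n) (x * y).
Proof.
case/dprodP=> _ _ cHK tiHK sAH sBK Hx Ky fx fy k.
case/(ball_setU sAH sBK cHK)=> i [j [u [v [<- ui vj e]]]].
have Hu := subsetP (ball_sub i sAH) _ ui.
have Kv := subsetP (ball_sub j sBK) _ vj.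
have xu : u^-1 * x = 1.
  apply/set1P; rewrite -[[set 1]]/(1 : {set gT}) -tiHK inE groupM ?groupV //=.
  by rewrite -[x](mulgK y) e !mulgA mulVg mul1g groupM ?groupV.
have {xu} xu : x = u by apply/eqP; rewrite eq_sym eq_mulVg1 xu.
have yv : y = v by move: e; rewrite xu => /mulgI.
by rewrite leq_add ?fx ?fy // ?xu ?yv.
Qed.

Lemma ball_cycle x k g : g \in ball [set x] k ->
  exists i, exists j, (i + j <= k)%N /\ g = x ^+ i * x ^- j.
Proof.
elim: k g => [|k IH] g.
  by rewrite ball0 => /eqP->; exists 0, 0; rewrite mulgV.
rewrite /ball expgS => /mulsgP[s g' ss /IH[i [j [le ->]]] ->].
move: ss; rewrite mem_sym !inE => /or3P[/eqP->|/eqP->|/eqP sV].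
- by exists i, j; rewrite mul1g leqW.
- by exists i.+1, j; rewrite mulgA -expgS addSn ltnS.
exists i, j.+1; rewrite addnS ltnS; split=> //.
rewrite -[s]invgK sV expgSr invMg mulgA mulgA; congr (_ * _).
by apply: commuteX; rewrite /commute mulVg mulgV.
Qed.

Lemma far_cycle x : far [set x] #[x]./2 (x ^+ #[x]./2).
Proof.
move=> k /ball_cycle[i [j [le e]]]; rewrite leqNgt; apply/negP=> lt.
have : x ^+ (#[x]./2 + j) == x ^+ i by rewrite expgD e mulgKV.
have hx : (#[x]./2.*2 <= #[x])%N by rewrite -{2}[#[x]]odd_double_half leq_addl.
rewrite eq_expg_mod_order !modn_small; first 1 last.
- by move: le lt hx; clear; lia.
- by move: le lt hx; clear; lia.
by move/eqP; move: le lt; clear; lia.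
Qed.

(** The element x * y^-1 has coordinates (1, 2), and none of the seven elements
    of the ball of radius 1 has. *)
Lemma far_pair x y : commute x y -> <[x]> :&: <[y]> = 1 ->
    #[x] = 3 -> #[y] = 3 ->
  far [set x; y; x * y] 2 (x * y^-1).
Proof.
move=> cxy ti x3 y3.
have x2 : x^-1 = x ^+ 2 by rewrite invg_expg x3.
have y2 : y^-1 = y ^+ 2 by rewrite invg_expg y3.
have uniq i j : (i < 3)%N -> (j < 3)%N -> x * y^-1 = x ^+ i * y ^+ j ->
    i = 1%N /\ j = 2%N.
  move=> lti ltj; rewrite y2 => e.
  have e' : x ^- i * x ^+ 1 = y ^+ j * y ^- 2.
    by apply/(canRL (mulgK _)); rewrite expg1 -mulgA e mulKg.
  have : x ^- i * x ^+ 1 \in <[x]> :&: <[y]>.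
    rewrite inE {2}e' !groupM ?groupV ?mem_cycle //.
  rewrite ti => /set1P e1; move: (e'); rewrite e1 => e2.
  have : x ^+ 1 == x ^+ i by rewrite eq_sym eq_mulVg1 e1.
  have : y ^+ j == y ^+ 2 by rewrite eq_mulgV1 -e2.
  by rewrite !eq_expg_mod_order x3 y3 !modn_small // => /eqP-> /eqP<-.
case=> [|[|//]].
  by rewrite ball0 => /eqP e; have [] := @uniq 0 0 isT isT; rewrite // e mulg1.
rewrite ball1 mem_sym !inE -!orbA => sxy.
have [i [j [lti ltj e ne]]] : exists i, exists j, [/\ (i < 3)%N, (j < 3)%N,
    x * y^-1 = x ^+ i * y ^+ j & (i, j) != (1%N, 2%N)].
  have inv z : (x * y^-1)^-1 == z -> x * y^-1 = z^-1 by move/eqP<-; rewrite invgK.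
  case/or4P: sxy => [/eqP e|/eqP e|/eqP e|].
  - by exists 0, 0; rewrite e mulg1.
  - by exists 1%N, 0; rewrite mulg1.
  - by exists 0, 1%N; rewrite mul1g.
  case/or4P=> [/eqP e|/inv e|/inv e|/inv e].
  - by exists 1%N, 1%N.
  - by exists 2, 0; rewrite mulg1 -x2.
  - by exists 0, 2; rewrite mul1g -y2.
  by exists 2, 2; rewrite -x2 -y2 -invMg -cxy.
by have [i1 j2] := uniq i j lti ltj e; rewrite i1 j2 in ne.
Qed.

Lemma far_singles (U : seq gT) G : \big[dprod/1]_(x <- U) <[x]> = G ->
  exists2 g, g \in G & far [set x in U] (\sum_(x <- U) #[x]./2) g.
Proof.
elim: U G => [|x U IH] G; first by exists 1 => // k; rewrite big_nil.
rewrite !big_cons => defG; have [[_ K _ defK] _ _ _] := dprodP defG.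
have [g Kg fg] := IH K defK; rewrite defK in defG.
exists (x ^+ #[x]./2 * g).
  rewrite -(dprodW defG) mem_mulg // mem_cycle //.
have -> : [set y in x :: U] = [set x] :|: [set y in U].
  by apply/setP=> y; rewrite !inE.
apply: (@far_dprod _ _ G <[x]>%G K) => //;
  rewrite ?sub1set ?cycle_id ?mem_cycle //.
  by apply/subsetP=> y; rewrite inE; apply: bigdprod_sub.
exact: far_cycle.
Qed.

Lemma block_gens_sub P U G : \big[dprod/1]_(x <- flat P ++ U) <[x]> = G ->
  block_gens P U \subset G.
Proof.
move=> defG; have bG := bigdprod_sub defG.
apply/subsetP=> x; rewrite mem_block_gens => /orP[/bG //|/mapP[p pP ->]].
by rewrite groupM // bG // mem_cat; apply/orP; left; apply/flatten_mapP;
  exists p; rewrite // !inE eqxx ?orbT.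
Qed.

Lemma far_blocks P U G : \big[dprod/1]_(x <- flat P ++ U) <[x]> = G ->
    (forall x, x \in flat P -> #[x] = 3) ->
  exists2 g, g \in G &
    far (block_gens P U) (\sum_(x <- flat P ++ U) #[x]./2) g.
Proof.
elim: P G => [|[x y] P IH] G.
  move=> /far_singles[g Gg fg] _; exists g => //.
  have -> : block_gens [::] U = [set x in U] by apply/setP=> x; rewrite !inE orbF.
  exact: fg.
rewrite -[flat (_ :: _)]/[:: x, y & flat P] !cat_cons !big_cons dprodA.
move=> defG ord3.
have [[H K defH defK] _ _ _] := dprodP defG.
have ord3' z : z \in flat P -> #[z] = 3.
  by move=> zP; rewrite ord3 // !inE zP !orbT.
have [g Kg fg] := IH K defK ord3'; rewrite defK defH in defG.
have [_ defH' cxy ti] := dprodP defH.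
have x3 : #[x] = 3 by rewrite ord3 // mem_head.
have y3 : #[y] = 3 by rewrite ord3 // !inE eqxx orbT.
have Hx : x \in H by rewrite -defH' (subsetP (mulG_subl _ _)) ?cycle_id.
have Hy : y \in H by rewrite -defH' (subsetP (mulG_subr _ _)) ?cycle_id.
exists (x * y^-1 * g); first by rewrite -(dprodW defG) mem_mulg // groupM ?groupV.
have -> : block_gens ((x, y) :: P) U = [set x; y; x * y] :|: block_gens P U.
  apply/setP=> z; rewrite !inE -!orbA.
  by case: (z == x) (z == y) (z == x * y) => [] [] [] //=; rewrite ?orbT.
rewrite addnA x3 y3.
apply: (far_dprod defG) => //.
- apply/subsetP=> z; rewrite !inE -orbA.
  by case/or3P=> /eqP-> //; rewrite groupM.
- exact: block_gens_sub defK.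
- by rewrite groupM ?groupV.
by apply: far_pair => //; apply/commute_sym/(centsP cxy); rewrite cycle_id.
Qed.

End FarElements.

(** * Diameters *)

Section Diameters.
Variables (gT : finGroupType) (G : {group gT}).
Hypothesis cGG : abelian G.
Implicit Types (A : {set gT}).

Lemma diam_wrt_eq A d : diam_wrt A G = Some d <->
  ball A d = G /\ (forall k, ball A k = G -> (d <= k)%N).
Proof.
rewrite /diam_wrt; case: ball_decidable => [ex|nex].
  case: ex_minnP => m /eqP mG mmin; split=> [[<-]|[dG dmin]].
    by split=> // k /eqP/mmin.
  by congr Some; apply/eqP; rewrite eqn_leq dmin // mmin // dG.
by split=> // -[dG _]; case: nex; exists d; rewrite dG.
Qed.

Lemma diam_wrt_gen A : <<A>> = G ->
  exists2 d, (d <= weight G)%N & diam_wrt A G = Some d.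
Proof.
move=> genA; have sAG : A \subset G by rewrite -genA subset_gen.
have wG : ball A (weight G) = G.
  by apply/eqP; rewrite eqEsubset ball_sub // sub_ball_weight.
have exG : exists k, ball A k == G by exists (weight G); rewrite wG.
case: (ex_minnP exG) => m /eqP mG' mmin; exists m; first by rewrite mmin // wG.
by apply/diam_wrt_eq; split=> // k /eqP/mmin.
Qed.

Lemma diam_wrt_weight A : A \subset G ->
  diam_wrt A G = Some (weight G) <->
  <<A>> = G /\ exists2 g, g \in G & far A (weight G) g.
Proof.
move=> sAG; split=> [/diam_wrt_eq[wG wmin]|[genA [g Gg fg]]].
  split.
    apply/eqP; rewrite eqEsubset gen_subG sAG -{1}wG.
    by apply: ball_sub; apply: subset_gen.
  case: (weight G) wmin wG => [|w] wmin wG; first by exists 1.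
  have : ~~ (G \subset ball A w).
    apply/negP=> sGw; have e : ball A w = G.
      by apply/eqP; rewrite eqEsubset ball_sub.
    by have := wmin w e; rewrite ltnn.
  case/subsetPn=> g Gg gw; exists g => // k gk; rewrite ltnNge.
  by apply: contra gw => kw; apply: ball_leq gk.
have [d dw dG] := diam_wrt_gen genA; rewrite dG; congr Some; apply/eqP.
rewrite eqn_leq dw fg //; have [-> _] := (diam_wrt_eq A d).1 dG.
exact: Gg.
Qed.

Lemma standard_diam P U A :
    block_basis G P U -> [set x in flat P ++ U] \subset sym A ->
    sym A \subset sym (block_gens P U) -> A \subset G ->
  diam_wrt A G = Some (weight G).
Proof.
move=> [defG permG ord3] sbA sAB sAG; apply/diam_wrt_weight=> //; split.
  apply/eqP; rewrite eqEsubset gen_subG sAG -{1}(bigdprodWY defG) gen_subG.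
  rewrite /= -gen_sym big_seq; elim/big_ind: _ => [|X Y sX sY|x xb].
  - exact: sub0set.
  - by rewrite subUset sX.
  by rewrite cycle_subG mem_gen // (subsetP sbA) // inE.
have [g Gg fg] := far_blocks defG ord3; exists g => // k gk.
rewrite (weight_basis permG); apply: fg; exact: (subsetP (ballS k sAB)).
Qed.

(** The maximum is attained by any basis. *)
Lemma diamE : diam G = Some (weight G).
Proof.
pose d A := odflt 0%N (diam_wrt A G).
have -> : diam G = Some (\max_(A : {set gT} | (A \subset G) && (<<A>> == G)) d A).
  rewrite /diam; apply: (big_rec2 (fun x y => x = Some y)) => // A x y.
  move=> /andP[_ /eqP genA] ->.
  by have [e _ dA] := diam_wrt_gen genA; rewrite /d dA.
congr Some; apply/eqP; rewrite eqn_leq; apply/andP; split.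
  apply/bigmax_leqP=> A /andP[_ /eqP genA].
  by have [e ew dA] := diam_wrt_gen genA; rewrite /d dA.
have [b defG bt] := abelian_structure cGG.
pose A := [set x in b].
have sAG : A \subset G by apply/subsetP=> x; rewrite inE; apply: bigdprod_sub.
have dA : diam_wrt A G = Some (weight G).
  apply: (@standard_diam [::] b) => //; first by split=> //=; rewrite bt.
    exact: sub_sym.
  apply/sym_sub/subsetP=> x xA; apply: (subsetP (sub_sym _)).
  by rewrite mem_block_gens; move: xA; rewrite inE => ->.
have genA : <<A>> = G by have [] := (diam_wrt_weight sAG).1 dA.
pose gen (B : {set gT}) := (B \subset G) && (<<B>> == G).
have := @leq_bigmax_cond _ gen d A.
by rewrite /gen /d dA sAG genA eqxx; apply.
Qed.

End Diameters.

(** * Reordering bases *)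

Lemma nth_sorted_min (t : nat) (s : seq nat) i :
    sorted leq s -> all (leq t) s -> (i < count_mem t s)%N ->
  nth 0%N s i = t.
Proof.
elim: s i => //= u s IH i us /andP[tu ts].
have [ut|ut] := eqVneq u t.
  case: i => [|i] //=; rewrite add1n ltnS.
  by apply: IH => //; apply: path_sorted us.
rewrite add0n => lt; exfalso; move: lt; rewrite (_ : count_mem t s = 0%N) //.
apply/count_memPn/negP=> /(allP (order_path_min leq_trans us)) ut'.
by move: ut; rewrite eqn_leq tu ut'.
Qed.

Lemma flat_pairs (T : Type) (x0 : T) (b : seq T) k : (k.*2 <= size b)%N ->
  flat [seq (nth x0 b i.*2, nth x0 b i.*2.+1) | i <- iota 0 k] ++ drop k.*2 b
    = b.
Proof.
elim: k b => [|k IH] b; first by rewrite drop0.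
case: b => [|x [|y b]] //; rewrite doubleS !ltnS => le.
rewrite /flat /= (iotaDl 1 0 k); do 2!congr (_ :: _).
rewrite -[RHS](IH b le) /flat -!map_comp.
by congr (flatten _ ++ _); apply: eq_map.
Qed.

Lemma size_flat (T : Type) (P : seq (T * T)) : size (flat P) = (size P).*2.
Proof. by elim: P => //= p P; rewrite /flat /= doubleS => ->. Qed.

Lemma nth_flat (T : Type) (x0 : T) (P : seq (T * T)) i : (i < size P)%N ->
  (nth x0 (flat P) i.*2, nth x0 (flat P) i.*2.+1) = nth (x0, x0) P i.
Proof.
elim: P i => // -[x y] P IH [|i] //= lti; exact: IH lti.
Qed.

(** An invariant factor that divides 3 is 3, the trivial one being excluded.
    So the entries 3 come first in the type. *)
Lemma ab_type_ge3 (gT : finGroupType) (G : {group gT}) :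
  3 \in ab_type G -> all (leq 3) (ab_type G).
Proof.
rewrite mem_rev => t3; apply/allP=> t; rewrite mem_rev => tt.
have t1 : (1 < t)%N by apply: (allP (abelian_type_gt1 G)).
have /orP[|/(dvdn_leq (ltnW t1)) //] := abelian_type_total tt t3.
by move/(prime_nt_dvdP (isT : prime 3) _) => -> //; rewrite neq_ltn t1 orbT.
Qed.

Lemma ab_type_sorted (gT : finGroupType) (G : {group gT}) :
  sorted leq (ab_type G).
Proof. by rewrite /ab_type rev_sorted; apply: abelian_type_sorted. Qed.

Theorem theorem2p2 (gT : finGroupType) (G : {group gT}) (hG : abelian G)
    (r : nat) (hr : size (ab_type G) = r)
    (A : {set gT}) (hA : A \subset G) :
  diam_wrt A G = diam G <->
  exists b : r.-tuple gT,
    [/\ standard_generating_seq G b,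
        sym [set x in b] \subset sym A &
        sym A \subset sym ([set x in b] :|: pair_products b (nu 3 G))].
Proof.
rewrite (diamE hG); split=> [/(diam_wrt_weight hG hA)[genA [g Gg fg]]|].
  have [P [U [[defG permG ord3] symE]]] := extremal_blocks hG genA Gg fg.
  (* The entries of P have the least possible order as soon as they exist, so
     that sorting U alone puts all the orders in increasing order. *)
  pose V := sort (relpre order leq) U.
  have permV : perm_eq (flat P ++ V) (flat P ++ U).
    by rewrite perm_cat2l perm_sort.
  have ordV : map order (flat P ++ V) = ab_type G.
    have ptype : perm_eq (map order (flat P ++ V)) (ab_type G).
      rewrite (permPl (perm_map _ permV)) (permPl permG).
      by rewrite perm_sym perm_rev.
    apply: (sorted_eq leq_trans anti_leq _ _ ptype); last exact: ab_type_sorted.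
    rewrite sorted_pairwise; last exact: leq_trans.
    rewrite map_cat pairwise_cat -!sorted_pairwise; try exact: leq_trans.
    apply/and3P; split.
    - apply/allrelP=> _ t /mapP[x xP ->] tV; rewrite ord3 //.
      have inT u : u \in map order (flat P) ++ map order V -> u \in ab_type G.
        by rewrite -map_cat (perm_mem ptype).
      have t3 : 3 \in ab_type G.
        by apply: inT; rewrite mem_cat -(ord3 x xP) (map_f order xP).
      by apply: (allP (ab_type_ge3 t3)); apply: inT; rewrite mem_cat tV orbT.
    - rewrite (_ : map _ _ = nseq (size (flat P)) 3); last first.
        rewrite -(size_map order (flat P)); apply/all_pred1P/allP.
        by move=> _ /mapP[x xP ->] /=; rewrite ord3.
      by elim: (size _) => // -[|n].
    by rewrite sorted_map; apply: sort_sorted => x y; apply: leq_total.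
  have szb : size (flat P ++ V) == r.
    by rewrite -hr -ordV size_map.
  exists (Tuple szb); split=> /=.
  - by split=> //; rewrite (perm_big _ permV).
  - rewrite symE; apply/sym_sub/subsetP=> x; rewrite inE (perm_mem permV) => xb.
    by apply: (subsetP (sub_sym _)); rewrite mem_block_gens xb.
  rewrite symE; apply/sym_sub/subsetP=> x; rewrite mem_block_gens => xb.
  apply: (subsetP (sub_sym _)); rewrite !inE (perm_mem permV).
  case/orP: xb => [->//|/mapP[p pP ->]]; apply/orP; right.
  have ltk : (index p P < (nu 3 G)./2)%N.
    suff le : (size P <= (nu 3 G)./2)%N by apply: leq_trans le; rewrite index_mem.
    rewrite -[size P]doubleK -size_flat half_leq // /nu -ordV map_cat count_cat.
    apply: leq_trans (leq_addr _ _); rewrite count_map -(size_filter).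
    by rewrite (all_filterP _) //; apply/allP=> y yP /=; rewrite ord3.
  apply/imsetP; exists (Ordinal ltk) => //=.
  have lt : (index p P < size P)%N by rewrite index_mem.
  have := nth_flat 1 lt; rewrite nth_index // => pE.
  have lt2 : ((index p P).*2.+1 < size (flat P))%N.
    by rewrite size_flat -doubleS leq_double.
  have /= p1 := congr1 fst pE; have /= p2 := congr1 snd pE.
  by rewrite !nth_cat lt2 (ltnW lt2) p1 p2.
case=> b [[defG ordb] sbA sAb].
pose k := (nu 3 G)./2.
pose P := [seq (nth 1 b i.*2, nth 1 b i.*2.+1) | i <- iota 0 k].
have k_nu : (k.*2 <= nu 3 G)%N by rewrite -[nu 3 G]odd_double_half leq_addl.
have k_b : (k.*2 <= size b)%N.
  by apply: leq_trans k_nu _; rewrite /nu -ordb count_map count_size.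
have bE : flat P ++ drop k.*2 b = b := flat_pairs 1 k_b.
apply: (@standard_diam _ _ hG P (drop k.*2 b)) => //; last first.
- apply: subset_trans sAb _; apply/sym_sub/subsetP=> x.
  move=> xb; apply: (subsetP (sub_sym _)); rewrite mem_block_gens bE.
  move: xb; rewrite !inE; case/orP=> [-> //|/imsetP[i _ ->]].
  apply/orP; right; apply/mapP.
  exists (nth 1 b i.*2, nth 1 b i.*2.+1) => //.
  by apply/mapP; exists (i : nat); rewrite // mem_iota ltn_ord.
- by rewrite bE; apply: subset_trans (sub_sym _) sbA.
rewrite /block_basis bE; split=> //; first by rewrite ordb perm_rev.
have o3 j : (j < nu 3 G)%N -> #[nth 1 b j] = 3.
  move=> ltj; have ltb : (j < size b)%N.
    by apply: leq_trans ltj _; rewrite /nu -ordb count_map count_size.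
  rewrite -(nth_map 1 0%N) // ordb; apply: nth_sorted_min => //.
    exact: ab_type_sorted.
  apply: ab_type_ge3; rewrite -has_pred1 has_count.
  exact: leq_ltn_trans (leq0n _) ltj.
move=> x /flatten_mapP[p /mapP[i]]; rewrite mem_iota add0n => /andP[_ ltk] ->.
have lt2 : (i.*2.+1 < nu 3 G)%N.
  by apply: leq_trans k_nu; rewrite -doubleS leq_double.
by rewrite !inE => /orP[/eqP->|/eqP->]; rewrite o3 // ltnW.
Qed.
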